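(* Every positive rational $a/b$ with $b$ squarefree is a finite sum of distinct unit fractions, each denominator being a product of three distinct primes. *)

(* Defs.v *)
From mathcomp Require Import all_boot all_order all_algebra.

Set Implicit Arguments.
Unset Strict Implicit.
Unset Printing Implicit Defensive.

(* 0 is not squarefree, since every d * d divides it. *)
Definition squarefree (n : nat) : Prop :=
  forall d : nat, d * d %| n -> d = 1.

Definition product_of_three_distinct_primes (n : nat) : Prop :=
  exists p q r : nat,
    [/\ prime p, prime q & prime r] /\
    [/\ p <> q, p <> r & q <> r] /\
    n = p * q * r.

(* Main.v *)
From Stdlib Require Import NArith.
Require Import Defs.
From mathcomp Require Import all_boot all_order all_algebra.
From mathcomp Require Import zify ring lra.
Import Order.TTheory GRing.Theory Num.Theory.
Local Open Scope ring_scope.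
Set Implicit Arguments.
Unset Strict Implicit.
Unset Printing Implicit Defensive.

(** Let N(n) be the product of the primes up to n.  By induction on n there is an
    interval of length at least 1/8 in which every M/N(n) is a sum of distinct unit
    fractions 1/(pq) with p, q <= n prime.  It starts from a computed interval for
    n = 17.  When n + 1 = p is prime, M/(p N(n)) is made into some M'/N(n) by
    subtracting fractions 1/(pq), where the sum of the 1/q has to lie in a prescribed
    residue class modulo p; so the subset sums of the 1/q have to cover Z/p.  For
    p < 1024 this is checked by computation.  For larger p it follows from a weak
    form of Olson's theorem (about the square root of p distinct residues b, with no
    two opposite, suffice) and Chebyshev's lower bound on the number of primes.
    Using a light set of q, or else its complement among all primes up to n, keeps
    the length of the interval.

    Dividing such an interval by a large prime l gives an interval of sums of
    1/(lpq), as close to 0 as desired.  It loses little when further primes p > l are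
    added through terms 1/(pqr) with q, r large and r fixed.  Finally, given a/b, a
    greedy subtraction of fractions 1/(6p), p > 3l, reaches that interval, and
    what remains is of the form M/N(n). *)

(** * Translates and sumsets modulo a prime *)

Definition sumset (V : finZmodType) (A B : {set V}) : {set V} :=
  [set x + y | x in A, y in B].

(** As [d] is a unit of ['F_p], the progression [a + d *+ k] runs through all residues. *)
Lemma translation_closed_setT (p : nat) (A : {set 'F_p}) (a d : 'F_p) :
  prime p -> d != 0 -> a \in A -> (forall x, x \in A -> x + d \in A) ->
  A = setT.
Proof.
move=> pr_p d0 aA AD; apply/setP=> x; rewrite inE.
have AM k : a + d *+ k \in A.
  by elim: k => [|k IHk]; rewrite ?mulr0n ?addr0 // mulrSr addrA AD.
suff -> : x = a + d *+ (((x - a) / d)%R : 'F_p) by exact: AM.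
by rewrite -mulr_natr natr_Zp mulrC divfK // addrC subrK.
Qed.

(** Induction on [#|B|] by Dyson's transform: for a shift [e], the pair [A], [B] is replaced by the
    union of [A] and [B + e] and by the part of [B] that [e] moves into [A]. The sum of the two
    sizes is kept, the sumset does not grow, and [e] is chosen so that the second set shrinks
    without becoming empty. *)
Lemma cauchy_davenport (p : nat) (A B : {set 'F_p}) :
  prime p -> A != set0 -> B != set0 ->
  (minn p (#|A| + #|B|).-1 <= #|sumset A B|)%N.
Proof.
move=> pr_p; have [n] := ubnP #|B|; elim: n A B => // n IHn A B ltB A0 B0.
have [b1 b1B] := set0Pn _ B0.
have leAAB : (#|A| <= #|sumset A B|)%N.
  rewrite -(card_imset (mem A) (addIr b1)); apply/subset_leq_card/subsetP => y.
  by case/imsetP=> x xA ->; apply: imset2_f.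
case: (leqP #|B| 1) => [B1|B2].
  have -> : #|B| = 1%N by apply/eqP; rewrite eqn_leq B1 card_gt0.
  by rewrite addn1 /= (leq_trans (geq_minr _ _)).
have [/eqP ->|AT] := boolP (A == setT).
  rewrite (leq_trans (geq_minl _ _)) //.
  have: (#|[set: 'F_p]| <= #|sumset setT B|)%N.
    apply/subset_leq_card/subsetP=> x _; rewrite -(subrK b1 x).
    by apply: imset2_f; rewrite ?inE.
  by rewrite cardsT card_Fp.
have [b2 b2B b21] : exists2 b2, b2 \in B & b2 != b1.
  have /set0Pn[b2] : B :\ b1 != set0.
    by rewrite -card_gt0; move: B2; rewrite (cardsD1 b1 B) b1B.
  by rewrite !inE => /andP[? ?]; exists b2.
(* Otherwise [A] would be closed under adding [b2 - b1], hence everything. With [e := a - b1] the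
   element [b1] survives in the new second set, while [b2] is lost. *)
have [a aA aN] : exists2 a, a \in A & a + (b2 - b1) \notin A.
  have [a0 a0A] := set0Pn _ A0.
  have [/exists_inP //|/exists_inPn H] :=
    boolP [exists x in A, x + (b2 - b1) \notin A].
  case/negP: AT; apply/eqP.
  apply: (@translation_closed_setT p A a0 (b2 - b1)) => //; first by rewrite subr_eq0.
  by move=> x /H; rewrite negbK.
pose e := a - b1.
pose Be := [set b + e | b in B].
pose B' := [set b in B | b + e \in A].
have cBe : #|Be| = #|B| by rewrite card_imset //; apply: addIr.
have cB' : #|A :&: Be| = #|B'|.
  rewrite -(card_imset (mem B') (addIr e)); apply: eq_card => x; rewrite inE.
  apply/andP/imsetP => [[xA /imsetP[b bB def]]|[b]].
    by exists b; rewrite // inE bB -def.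
    by rewrite inE => /andP[bB bA] ->; split=> //; apply/imsetP; exists b.
have b1B' : b1 \in B' by rewrite inE b1B /e addrC subrK.
have ltB' : (#|B'| < #|B|)%N.
  apply/proper_card/properP; split; first by apply/subsetP=> x; rewrite inE => /andP[].
  exists b2 => //; rewrite inE b2B /= /e.
  by rewrite addrCA in aN *.
have sub : sumset (A :|: Be) B' \subset sumset A B.
  apply/subsetP=> x /imset2P[y b]; rewrite !inE => /orP[yA /andP[bB _] ->|].
    exact: imset2_f.
  case/imsetP=> b' b'B -> /andP[bB bA] ->.
  by rewrite -addrA addrC [e + b]addrC; apply: imset2_f.
apply: leq_trans (subset_leq_card sub).
apply: leq_trans (IHn _ _ _ _ _).
- by rewrite -cB' cardsUI cBe.
- exact: leq_trans ltB' _.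
- by apply/set0Pn; exists a; rewrite inE aA.
- by apply/set0Pn; exists b1.
Qed.

(** The function of [c] that Erdős, Heilbronn and Olson use to study subset sums. It is symmetric
    and subadditive in [c], does not change when [X] is replaced by its complement, and counts the
    new elements that a further summand [c] brings to a set [X] of sums. *)
Definition leave (V : finZmodType) (X : {set V}) (c : V) : nat :=
  #|[set x in X | x + c \notin X]|.

Lemma card_leave (V : finZmodType) (X : {set V}) (c : V) :
  (leave X c + #|[set x in X | (x + c)%R \in X]|)%N = #|X|.
Proof.
rewrite addnC -[RHS](cardsID [set x | x + c \in X] X) /leave.
by congr addn; apply: eq_card => x; rewrite !inE // andbC.
Qed.

Lemma leave0 (V : finZmodType) (X : {set V}) : leave X 0 = 0%N.
Proof.
apply/eqP; rewrite cards_eq0; apply/eqP/setP=> x.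
by rewrite !inE addr0 andbN.
Qed.

Lemma leaveN (V : finZmodType) (X : {set V}) (c : V) : leave X (- c) = leave X c.
Proof.
apply: (@addIn #|[set x in X | x + c \in X]|); rewrite card_leave.
rewrite -(card_leave X (- c)); congr addn.
rewrite -(card_imset _ (addIr c)); apply: eq_card => x.
rewrite !inE; apply/imsetP/andP => [[y]|[xX xcX]].
  by rewrite inE => /andP[yX ycX] ->; rewrite addrK.
by exists (x - c); rewrite ?inE subrK ?xX ?xcX.
Qed.

Lemma leaveD (V : finZmodType) (X : {set V}) (c d : V) :
  (leave X (c + d)%R <= leave X c + leave X d)%N.
Proof.
rewrite /leave; set Y := [set x in X | x + d \notin X].
set Z := [set x in X | x + c \notin X].
rewrite -[#|Z|](card_imset _ (addIr (- d))) -cardsUI (leq_trans _ (leq_addr _ _)) //.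
apply/subset_leq_card/subsetP=> x; rewrite !inE addrA addrAC => /andP[xX xcd].
have [xd|] := boolP (x + d \in X); last first.
  by move=> _; rewrite xX orbT.
by apply/orP; left; apply/imsetP; exists (x + d); rewrite ?inE ?xd // addrK.
Qed.

Lemma leaveC (V : finZmodType) (X : {set V}) (c : V) : leave (~: X) c = leave X c.
Proof.
rewrite -leaveN /leave -[RHS](card_imset _ (addIr c)); apply: eq_card => x.
rewrite !inE negbK; apply/andP/imsetP => [[xX xcX]|[y]].
  by exists (x - c); rewrite ?inE subrK ?xX ?xcX.
by rewrite inE => /andP[yX ycX] ->; rewrite addrK.
Qed.

Lemma card_translateU (V : finZmodType) (X : {set V}) (c : V) :
  #|X :|: [set x + c | x in X]| = (#|X| + leave X c)%N.
Proof.
have -> : X :|: [set x + c | x in X] = X :|: ([set x + c | x in X] :\: X).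
  by apply/setP=> x; rewrite !inE; case: (x \in X).
rewrite cardsU (_ : X :&: _ = set0) ?cards0 ?subn0; last first.
  by apply/setP=> x; rewrite !inE; case: (x \in X).
congr addn; rewrite /leave -[RHS](card_imset _ (addIr c)).
apply: eq_card => x; rewrite !inE; apply/andP/imsetP => [[xN /imsetP[y yX def]]|[y]].
  by exists y; rewrite // inE yX -def.
by rewrite inE => /andP[yX ycN] ->; split=> //; apply/imsetP; exists y.
Qed.

(** Averaging over [C]: a pair of [c] and [x] with [x] and [x + c] both in [X] is determined by
    [(x, x + c)], so there are at most [#|X| ^ 2] such pairs. If every [c] kept more than half of
    [X] inside [X], there would be more. *)
Lemma exists_leave (V : finZmodType) (X C : {set V}) :
  (0 < #|X|)%N -> (2 * #|X| <= #|C|)%N ->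
  exists2 c, c \in C & (#|X| <= 2 * leave X c)%N.
Proof.
move=> X0 leXC; have [/exists_inP //|/exists_inPn H] :=
  boolP [exists c in C, (#|X| <= 2 * leave X c)%N].
have stay c : c \in C -> (#|X| < 2 * #|[set x in X | (x + c)%R \in X]|)%N.
  by move/H; have := card_leave X c; lia.
have : (\sum_(c in C) #|X| < \sum_(c in C) 2 * #|[set x in X | (x + c)%R \in X]|)%N.
  rewrite ltn_neqAle leq_sum ?andbT; last by move=> c /stay/ltnW.
  have [c cC] : exists c, c \in C by apply/set0Pn; rewrite -card_gt0; lia.
  rewrite (bigD1 c) // [X in _ != X](bigD1 c) //= neq_ltn -addSn leq_add //.
    exact: stay.
  by apply: leq_sum => i /andP[/stay/ltnW].
rewrite sum_nat_const -big_distrr /= => lt.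
have: (\sum_(c in C) #|[set x in X | (x + c)%R \in X]| <= #|X| * #|X|)%N.
  rewrite -cardsX; under eq_bigr do rewrite -sum1_card.
  rewrite pair_big_dep /= sum1_card.
  pose f (u : V * V) := (u.2, u.2 + u.1).
  have f_inj : injective f by move=> [c x] [d y] [/= -> /addrI ->].
  rewrite -(card_imset _ f_inj); apply/subset_leq_card/subsetP => u.
  by case/imsetP=> -[c x]; case/andP=> /= _; rewrite inE => /andP[xX xcX] ->;
    rewrite inE /= xX xcX.
have: (#|X| * (2 * #|X|) <= #|X| * #|C|)%N by rewrite leq_mul2l leXC orbT.
move: lt; set s := (\sum_(c in C) _)%N; set x := #|X|; set k := #|C|.
by rewrite [(k * x)%N]mulnC; lia.
Qed.

Fixpoint iter_sumset (V : finZmodType) (D : {set V}) (j : nat) : {set V} :=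
  if j is j'.+1 then sumset (iter_sumset D j') D else [set 0].

Lemma mem0_iter_sumset (V : finZmodType) (D : {set V}) (j : nat) :
  0 \in D -> 0 \in iter_sumset D j.
Proof.
move=> D0; elim: j => [|j IHj]; first by rewrite /= inE.
by rewrite -(addr0 0) /=; apply: imset2_f.
Qed.

Lemma card_iter_sumset (p : nat) (D : {set 'F_p}) (j : nat) :
  prime p -> 0 \in D -> (minn p (j * #|D|.-1).+1 <= #|iter_sumset D j|)%N.
Proof.
move=> pr_p D0; elim: j => [|j IHj]; first by rewrite mul0n cards1 geq_minr.
have Dn0 : D != set0 by apply/set0Pn; exists 0.
have Jn0 : iter_sumset D j != set0.
  by apply/set0Pn; exists 0; apply: mem0_iter_sumset.
have := cauchy_davenport pr_p Jn0 Dn0; rewrite /= mulSn.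
have : (0 < #|D|)%N by rewrite card_gt0.
move: IHj; set u := (j * _)%N; set a := #|sumset _ _|; set c := #|iter_sumset D j|.
by have := prime_gt0 pr_p; clearbody u a c; move: #|D| => d; lia.
Qed.

Lemma leave_iter_sumset (V : finZmodType) (X D : {set V}) (m j : nat) (c : V) :
  (forall b, b \in D -> leave X b <= m)%N -> c \in iter_sumset D j ->
  (leave X c <= j * m)%N.
Proof.
move=> Dm; elim: j c => [|j IHj] c /=; first by rewrite inE => /eqP->; rewrite leave0.
case/imset2P=> x b xJ bD ->; rewrite mulSn addnC.
by rewrite (leq_trans (leaveD _ _ _)) // leq_add ?IHj ?Dm.
Qed.

(** * Subset sums modulo a prime *)

(** The set [D] of 0 and all [b], [- b] has at least [2 m + 1] elements, so by Cauchy-Davenport its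
    [j]-fold sumset, with [j] the ceiling of [#|X| / m], has at least [2 #|X|]. It thus contains
    some [c] with [leave X c] at least [#|X| / 2], and by subadditivity some [b] gets a [j]-th part
    of this. For [#|X| <= m] this [j] is 1; otherwise [j m < 2 #|X|], which yields [m / 4]. *)
Lemma leave_large (p m : nat) (X B : {set 'F_p}) :
  prime p -> (0 < m <= #|B|)%N -> 0 \notin B ->
  (forall b c, b \in B -> c \in B -> b + c != 0) ->
  (0 < #|X|)%N -> (2 * #|X| <= p)%N ->
  exists2 b, b \in B & (#|X| <= 2 * leave X b)%N || (m <= 4 * leave X b)%N.
Proof.
move=> pr_p /andP[m0 mB] B0 Bopp X0 Xp.
pose D := 0 |: (B :|: [set - b | b in B]).
have cD : (2 * m <= #|D|.-1)%N.
  have cN : #|[set - b | b in B]| = #|B| by rewrite card_imset //; apply: oppr_inj.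
  rewrite cardsU1 /= cardsU cN.
  rewrite (_ : B :&: _ = set0) ?cards0 ?subn0; last first.
    apply/setP=> x; rewrite !inE; apply/negbTE/negP => /andP[xB /imsetP[y yB xy]].
    by have := Bopp _ _ xB yB; rewrite xy addNr eqxx.
  rewrite !inE (negbTE B0) /= (_ : (0 \in _) = false) /=.
    by rewrite mul2n -addnn; apply: (leq_add mB mB).
  apply/negbTE/negP => /imsetP[y yB /eqP]; rewrite eq_sym oppr_eq0 => /eqP y0.
  by rewrite -y0 yB in B0.
pose j := ((#|X| + m.-1) %/ m)%N.
have jm1 : (#|X| <= j * m)%N.
  have := divn_eq (#|X| + m.-1) m; have := ltn_pmod (#|X| + m.-1) m0.
  rewrite -/j; lia.
have jm2 : (j * m <= #|X| + m.-1)%N by apply: leq_divM.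
have cJ : (2 * #|X| <= #|iter_sumset D j|)%N.
  have D0 : 0 \in D by rewrite !inE eqxx.
  apply: leq_trans (card_iter_sumset j pr_p D0); rewrite leq_min Xp /=.
  have : (2 * (j * m) <= j * #|D|.-1)%N by rewrite mulnCA leq_mul2l cD orbT.
  by move=> /leqW; apply: leq_trans; rewrite leq_mul2l jm1.
have [c cj Xc] := exists_leave X0 cJ.
have [/exists_inP //|/exists_inPn small] := boolP [exists b in B,
  (#|X| <= 2 * leave X b)%N || (m <= 4 * leave X b)%N].
pose mu := (\max_(b in B) leave X b)%N.
have muP : (2 * mu < #|X|)%N && (4 * mu < m)%N.
  rewrite /mu; elim/big_ind: _ => [|u v /andP[? ?] /andP[? ?]|b bB]; last 1 first.
  - by have := small _ bB; rewrite negb_or -!ltnNge.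
  - by rewrite !muln0 X0 m0.
  - lia.
have Dmu b : b \in D -> (leave X b <= mu)%N.
  rewrite !inE => /or3P[/eqP->|bB|/imsetP[b' b'B ->]]; first by rewrite leave0.
    exact: leq_bigmax_cond.
  by rewrite leaveN; apply: leq_bigmax_cond.
have := leave_iter_sumset Dmu cj.
case/andP: muP => mu1 mu2 leXj; clear small Dmu cJ cj; clearbody mu j.
move: (leave X c) Xc leXj => l Xc leXj; move: #|X| X0 Xp jm1 jm2 Xc mu1 => x X0 Xp jm1 jm2 Xc mu1.
have [xm|mx] := leqP x m.
  have j1 : (j < 2)%N.
    have: (j * m < 2 * m)%N by move: jm2; set u := (j * m)%N; lia.
    by rewrite ltn_pmul2r.
  have : (j * mu <= 1 * mu)%N by rewrite leq_mul2r -ltnS j1 orbT.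
  lia.
have h1 : (x * m <= 2 * (j * mu) * m)%N by rewrite leq_mul2r; lia.
have h2 : (2 * (j * mu) * m = 2 * mu * (j * m))%N by rewrite -!mulnA [(j * (mu * m))%N]mulnCA.
have h3 : (2 * mu * (j * m) <= 2 * mu * (2 * x))%N by rewrite leq_mul2l; lia.
have h4 : (x * (4 * mu) < x * m)%N by rewrite ltn_pmul2l.
have h5 : (2 * mu * (2 * x) = x * (4 * mu))%N by lia.
by move: h1; rewrite h2 => /leq_trans/(_ h3); rewrite h5 leqNgt h4.
Qed.

Definition subset_sums (V : finZmodType) (A : {set V}) : {set V} :=
  [set \sum_(a in S) a | S : {set V} in powerset A].

Lemma subset_sums_gt0 (V : finZmodType) (A : {set V}) : (0 < #|subset_sums A|)%N.
Proof.
rewrite card_gt0; apply/set0Pn; exists 0; apply/imsetP; exists set0.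
  by rewrite inE sub0set.
by rewrite big_set0.
Qed.

Lemma card_subset_sumsU1 (V : finZmodType) (A : {set V}) (b : V) :
  b \notin A ->
  (#|subset_sums A| + leave (subset_sums A) b <= #|subset_sums (b |: A)|)%N.
Proof.
move=> bA; rewrite -card_translateU; apply/subset_leq_card/subsetP=> x.
rewrite inE => /orP[/imsetP[S SA ->]|/imsetP[_ /imsetP[S SA ->] ->]].
  by apply: imset_f; rewrite !inE in SA *; rewrite (subset_trans SA) // subsetUr.
rewrite inE in SA; apply/imsetP; exists (b |: S); first by rewrite inE setUS.
by rewrite big_setU1 1?addrC //; apply: contra bA => /(subsetP SA).
Qed.

Definition sums_reach (V : finZmodType) (B : {set V}) (i x : nat) : Prop :=
  exists A : {set V}, [/\ A \subset B, (#|A| <= i)%N & (x <= #|subset_sums A|)%N].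

Lemma sums_reachS (p M i : nat) (B A : {set 'F_p}) :
  prime p -> 0 \notin B -> (forall b c, b \in B -> c \in B -> b + c != 0) ->
  (0 < M)%N -> (M + i <= #|B|)%N -> A \subset B -> (#|A| <= i)%N ->
  let x := #|subset_sums A| in (x < p)%N ->
  exists y, sums_reach B i.+1 y /\
    ((2 * x + minn x (p - x) <= 2 * y)%N \/ (4 * x + M <= 4 * y)%N).
Proof.
move=> pr_p B0 Bopp M0 MB AB Ai x xp.
have cBA : (0 < M <= #|B :\: A|)%N.
  by rewrite M0 cardsD (setIidPr AB); lia.
have BA0 : 0 \notin B :\: A by rewrite inE (negbTE B0) andbF.
have BAopp b c : b \in B :\: A -> c \in B :\: A -> b + c != 0.
  by rewrite !inE => /andP[_ ?] /andP[_ ?]; apply: Bopp.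
have cX : (x + #|~: subset_sums A| = p)%N by rewrite cardsC card_Fp.
have [b bBA lv] : exists2 b, b \in B :\: A &
  ((minn x (p - x) <= 2 * leave (subset_sums A) b)
    || (M <= 4 * leave (subset_sums A) b))%N.
  have x0 : (0 < x)%N := subset_sums_gt0 A.
  have [xp2|px2] := leqP (2 * x) p.
    have [b bBA H] := leave_large pr_p cBA BA0 BAopp x0 xp2.
    exists b => //; case/orP: H => H; apply/orP; [left|by right].
    by apply: leq_trans H; apply: geq_minl.
  have [||b bBA H] := leave_large pr_p cBA BA0 BAopp (X := ~: subset_sums A).
  - by rewrite -(ltn_add2l x) addn0 cX.
  - have -> : #|~: subset_sums A| = (p - x)%N by rewrite -[p in RHS]cX addKn.
    by move: px2; clear; lia.
  rewrite leaveC in H; exists b => //; case/orP: H => H; apply/orP; [left|by right].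
  apply: leq_trans H; rewrite geq_min orbC -[p in (p - x)%N]cX addKn leqnn.
  by [].
move: bBA; rewrite inE => /andP[bA bB].
have := card_subset_sumsU1 bA; rewrite -/x => le.
exists #|subset_sums (b |: A)|; split.
  exists (b |: A); split=> //; first by rewrite subUset sub1set bB.
  by rewrite cardsU1 bA add1n ltnS.
move: le lv; move: (leave _ _) => l; move: #|_| => y; move: (minn _ _) => s.
by clear; clearbody x => le /orP[lv|lv]; [left|right]; lia.
Qed.

(* While [#|X| <= M / 2] one more summand multiplies [#|X|] by 3/2; then it adds
   [M / 4] until fewer than [M / 2] residues are missing; then it halves their
   number. *)
Lemma subset_sums_full (p M t1 t2 t3 : nat) (B : {set 'F_p}) :
  prime p -> 0 \notin B -> (forall b c, b \in B -> c \in B -> b + c != 0) ->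
  (0 < M)%N -> (M + (t1 + t2 + t3) <= #|B|)%N ->
  (2 ^ t1 * M <= 3 ^ t1)%N -> (4 * p <= t2 * M)%N -> (M <= 2 ^ t3)%N ->
  subset_sums B = setT.
Proof.
move=> pr_p B0 Bopp M0 MB h1 h2 h3.
have full (A : {set 'F_p}) : A \subset B -> (p <= #|subset_sums A|)%N -> subset_sums B = setT.
  move=> AB pA; apply/setP=> x; rewrite inE.
  have: x \in subset_sums A.
    have/eqP-> : subset_sums A == setT by rewrite eqEcard subsetT cardsT card_Fp.
    by rewrite inE.
  case/imsetP=> S SA ->; apply: imset_f; rewrite inE in SA.
  by rewrite inE (subset_trans SA).
case: (boolP (subset_sums B == setT)) => [/eqP //|nfull].
have small (A : {set 'F_p}) : A \subset B -> (#|subset_sums A| < p)%N.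
  by move=> AB; rewrite ltnNge; apply/negP=> /(full _ AB)/eqP; apply/negP.
have P1 t : (t <= t1 + t2 + t3)%N -> exists2 x, sums_reach B t x &
    (3 ^ t <= 2 ^ t * x)%N \/ (M <= 2 * x)%N.
  elim: t => [|t IHt] lt.
    exists 1%N; last by left.
    exists set0; rewrite sub0set cards0; split=> //; exact: subset_sums_gt0.
  have [|x [A [AB At Ax]] Hx] := IHt; first by lia.
  case: (leqP M (2 * #|subset_sums A|)) => [MA|AM].
    exists #|subset_sums A|; last by right.
    by exists A; split=> //; lia.
  have {}Hx : (3 ^ t <= 2 ^ t * #|subset_sums A|)%N.
    case: Hx => [Hx|]; last by lia.
    by apply: leq_trans Hx _; rewrite leq_mul2l Ax orbT.
  have [|y [yr H]] := @sums_reachS p M t B A pr_p B0 Bopp M0 _ AB At (small _ AB).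
    by apply: leq_trans MB; rewrite leq_add2l; lia.
  exists y => //.
  case: (leqP M (2 * y)) => [|yM]; [by right|left].
  have Bp : (#|B| <= p)%N by rewrite -[leqRHS](card_Fp pr_p) max_card.
  have {}H : (3 * #|subset_sums A| <= 2 * y)%N.
    move: AM MB Bp H; clear; move: #|subset_sums A| #|B| => x k AM MB Bp.
    by case; lia.
  rewrite !expnS.
  have : (3 * 3 ^ t <= 3 * (2 ^ t * #|subset_sums A|))%N by rewrite leq_mul2l Hx.
  have : (2 ^ t * (3 * #|subset_sums A|) <= 2 ^ t * (2 * y))%N by rewrite leq_mul2l H orbT.
  by lia.
have P2 t : (t <= t2 + t3)%N -> exists2 x, sums_reach B (t1 + t) x &
    (M <= 2 * x)%N /\ ((t * M <= 4 * x)%N \/ (2 * (p - x) < M)%N).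
  elim: t => [|t IHt] lt.
    have [|x xr Hx] := P1 t1; first by lia.
    exists x; first by rewrite addn0.
    split; last by left; lia.
    case: Hx => // Hx; have := leq_trans h1 Hx.
    by rewrite leq_mul2l expn_eq0 /=; lia.
  have [|x [A [AB At Ax]] [Hx Hx']] := IHt; first by lia.
  have [|y [yr H]] := @sums_reachS p M (t1 + t) B A pr_p B0 Bopp M0 _ AB At (small _ AB).
    by apply: leq_trans MB; rewrite leq_add2l; lia.
  rewrite addnS; exists y => //; split; first by lia.
  have := small _ AB.
  case: Hx' => Hx'; last by right; lia.
  case: (leqP M (2 * (p - #|subset_sums A|))) => [MA|]; last by right; lia.
  by left; rewrite mulSn; lia.
have P3 t : (t <= t3)%N -> exists2 x, sums_reach B (t1 + t2 + t) x &
    (M <= 2 * x)%N /\ (2 ^ t * (2 * (p - x)) < M)%N.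
  elim: t => [|t IHt] lt.
    have [|x xr [Hx Hx']] := P2 t2; first by lia.
    by exists x; rewrite ?addn0 // mul1n; split=> //; lia.
  have [|x [A [AB At Ax]] [Hx Hx']] := IHt; first by lia.
  have [|y [yr H]] := @sums_reachS p M (t1 + t2 + t) B A pr_p B0 Bopp M0 _ AB At (small _ AB).
    by apply: leq_trans MB; rewrite leq_add2l; lia.
  rewrite addnS; exists y => //; split; first by lia.
  have {}H : (2 * (2 * (p - y)) <= 2 * (p - x))%N.
    have : (2 * (p - x) <= 2 ^ t * (2 * (p - x)))%N by rewrite leq_pmull ?expn_gt0.
    have := small _ AB; lia.
  rewrite expnS -mulnA mulnCA; apply: leq_ltn_trans Hx'.
  by rewrite leq_mul2l H orbT.
(* As [M <= 2 ^ t3], the bound [Hx] leaves no residue missing. *)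
have [x [A [AB _ Ax]] [_ Hx]] := P3 t3 (leqnn _).
have := small _ AB; case: (posnP (p - x)) => [|px]; first by lia.
have : (2 ^ t3 * 1 <= 2 ^ t3 * (2 * (p - x)))%N by rewrite leq_mul2l; lia.
lia.
Qed.

(** * Sums of unit fractions and covers of residues *)

Definition covers (p : nat) (T : seq nat) : Prop :=
  forall t : 'F_p, exists2 s : seq nat, subseq s T & \sum_(n <- s) (n%:R)^-1 = t.

Lemma natF_neq0 (p n : nat) : prime p -> (0 < n < p)%N -> (n%:R : 'F_p) != 0.
Proof.
move=> pr_p /andP[n0 np]; rewrite -(dvdn_pcharf (pchar_Fp pr_p)).
by rewrite gtnNdvd.
Qed.

Lemma natF_inj (p m n : nat) : prime p -> (m < p)%N -> (n < p)%N ->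
  (m%:R : 'F_p) = n%:R -> m = n.
Proof.
move=> pr_p mp np /(congr1 (@nat_of_ord _)); rewrite !val_Fp_nat //.
by rewrite !modn_small.
Qed.

(** Reciprocals of distinct odd [q < p] are distinct and nonzero, and no two are opposite: [q + r]
    is even and lies strictly between 0 and [2 p], so the odd [p] does not divide it. This also
    holds for [q = r]. *)
Lemma covers_odd (p M t1 t2 t3 : nat) (T : seq nat) :
  prime p -> uniq T -> (forall q, q \in T -> odd q && (q < p)%N) ->
  (0 < M)%N -> (M + (t1 + t2 + t3) <= size T)%N ->
  (2 ^ t1 * M <= 3 ^ t1)%N -> (4 * p <= t2 * M)%N -> (M <= 2 ^ t3)%N ->
  (2 < p)%N -> covers p T.
Proof.
move=> pr_p Tu Tp M0 MT h1 h2 h3 p2.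
pose f (n : nat) : 'F_p := (n%:R)^-1.
have f_inj : {in T &, injective f}.
  move=> m n /Tp/andP[_ mp] /Tp/andP[_ np] /invr_inj; exact: natF_inj.
pose B := [set x in map f T].
have cB : #|B| = size T.
  by rewrite cardsE (card_uniqP _) ?size_map // map_inj_in_uniq.
have q0 q : q \in T -> (q%:R : 'F_p) != 0.
  by move=> /Tp/andP[qo qp]; apply: natF_neq0; rewrite // odd_gt0.
have B0 : 0 \notin B.
  rewrite inE; apply/mapP => -[q /q0 qT /eqP].
  by rewrite eq_sym invr_eq0 (negbTE qT).
have Bopp b c : b \in B -> c \in B -> b + c != 0.
  rewrite !inE => /mapP[q qT ->] /mapP[r rT ->].
  rewrite addr_eq0 -invrN (inj_eq invr_inj) -addr_eq0 -natrD.
  rewrite -(dvdn_pcharf (pchar_Fp pr_p)).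
  have /andP[qo qp] := Tp _ qT; have /andP[ro rp] := Tp _ rT.
  apply/negP => /dvdnP[[|[|k]] E]; [lia | | lia].
  have : odd p by case: (even_prime pr_p) => [pE|//]; rewrite pE in p2.
  by rewrite -(mul1n p) -E oddD qo ro.
rewrite -cB in MT.
have := subset_sums_full pr_p B0 Bopp M0 MT h1 h2 h3 => full t.
have : t \in subset_sums B by rewrite full inE.
case/imsetP=> S; rewrite inE => /subsetP SB ->.
exists [seq n <- T | f n \in S]; first exact: filter_subseq.
rewrite -[LHS](big_map f predT id) -(filter_map f [pred y | y \in S]).
rewrite -[RHS]big_enum /=.
apply: perm_big; apply: uniq_perm; rewrite ?enum_uniq //.
  by rewrite filter_uniq // map_inj_in_uniq.
move=> x; rewrite mem_filter mem_enum /=; case: (boolP (x \in S)) => //= xS.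
by have := SB _ xS; rewrite inE => ->.
Qed.

Lemma covers_mull (p r : nat) (T : seq nat) :
  prime p -> (r%:R : 'F_p) != 0 -> covers p T -> covers p (map (muln r) T).
Proof.
move=> pr_p r0 Tc t; have [s sT sE] := Tc (r%:R * t).
exists (map (muln r) s); first exact: map_subseq.
rewrite big_map; under eq_bigr do rewrite natrM invfM.
by rewrite -big_distrr /= sE mulrA mulVf // mul1r.
Qed.

Definition usum (s : seq nat) : rat := \sum_(n <- s) (n%:R)^-1.

Lemma usum_ge0 s : 0 <= usum s.
Proof. by apply: sumr_ge0 => n _; rewrite invr_ge0 ler0n. Qed.

Lemma usum_cons n s : usum (n :: s) = (n%:R)^-1 + usum s.
Proof. exact: big_cons. Qed.

Lemma usum_cat s t : usum (s ++ t) = usum s + usum t.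
Proof. exact: big_cat. Qed.

Lemma usum_map_mul r s : usum (map (muln r) s) = (r%:R)^-1 * usum s.
Proof.
rewrite /usum big_map big_distrr /=; apply: eq_bigr => n _.
by rewrite natrM invfM.
Qed.

Lemma usum_filterC (P : pred nat) s :
  usum [seq n <- s | P n] + usum [seq n <- s | ~~ P n] = usum s.
Proof. by rewrite /usum !big_filter [RHS](bigID P). Qed.

Lemma usum_subset s t : uniq s -> {subset s <= t} -> usum s <= usum t.
Proof.
move=> su st; rewrite -(usum_filterC (mem s) t) -[leLHS]addr0.
apply: lerD; last exact: usum_ge0.
have -> : usum s = usum [seq n <- undup t | n \in s].
  apply: perm_big; apply: uniq_perm; rewrite ?filter_uniq ?undup_uniq //.
  move=> x; rewrite mem_filter mem_undup.
  by case: (boolP (x \in s)) => [/st ->|].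
rewrite filter_undup; elim: [seq _ <- t | _] => //= n r IHr.
rewrite [usum (n :: r)]/usum big_cons -/(usum r).
have n0 : 0 <= (n%:R)^-1 :> rat by rewrite invr_ge0 ler0n.
by case: ifP => _; rewrite ?[usum (n :: _)]/usum ?big_cons -/(usum _); lra.
Qed.

Lemma usum_complement s t : uniq s -> uniq t -> {subset s <= t} ->
  usum [seq n <- t | n \notin s] = usum t - usum s.
Proof.
move=> su tu st; rewrite -(usum_filterC (mem s) t) addrAC.
suff -> : usum [seq n <- t | n \in s] = usum s by rewrite subrr add0r.
apply: perm_big; apply: uniq_perm; rewrite ?filter_uniq //.
by move=> x; rewrite mem_filter andb_idr // => /st.
Qed.

Lemma usum_common_denominator (N : nat) (s : seq nat) :
  (0 < N)%N -> (forall n, n \in s -> n %| N)%N ->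
  usum s = (\sum_(n <- s) (N %/ n)%N)%:R / N%:R.
Proof.
move=> N0 sN; rewrite natr_sum mulr_suml /usum; apply: eq_big_seq => n /sN nN.
have n0 : (n%:R : rat) != 0 by rewrite pnatr_eq0 -lt0n (dvdn_gt0 N0).
have N0' : (N%:R : rat) != 0 by rewrite pnatr_eq0 -lt0n.
apply: (mulIf N0'); rewrite divfK //.
by rewrite -[in LHS](divnK nN) natrM mulrC mulfK.
Qed.

(** Modulo [p] the numerator over [N] of a sum of [1/n] is [N] times the sum of the inverses, so the
    cover is asked for the residue [M / N]. *)
Lemma covers_residue (p N M : nat) (T : seq nat) :
  prime p -> ~~ (p %| N)%N -> (forall n, n \in T -> n %| N)%N -> covers p T ->
  exists s c, [/\ subseq s T, usum s = c%:R / N%:R & c = M %[mod p]].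
Proof.
move=> pr_p pN TN Tc.
have N0 : (0 < N)%N by case: N pN {TN} => //; rewrite dvdn0.
have NF : (N%:R : 'F_p) != 0 by rewrite -(dvdn_pcharf (pchar_Fp pr_p)).
have [s sT sE] := Tc (M%:R / N%:R).
have sN n : n \in s -> (n %| N)%N by move/(mem_subseq sT); apply: TN.
exists s, (\sum_(n <- s) (N %/ n))%N; split=> //; first exact: usum_common_denominator.
suff : ((\sum_(n <- s) (N %/ n))%N%:R : 'F_p) = M%:R.
  by move/(congr1 (@nat_of_ord _)); rewrite !val_Fp_nat.
rewrite -[RHS](divfK NF) -sE mulr_suml natr_sum; apply: eq_big_seq => n /sN nN.
have n0 : (n%:R : 'F_p) != 0.
  rewrite -(dvdn_pcharf (pchar_Fp pr_p)); apply: contra pN => pn.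
  exact: dvdn_trans nN.
by rewrite -[in RHS](divnK nN) natrM mulrC mulfK.
Qed.

(** * The primes up to n and their product *)

Definition primes_upto (n : nat) : seq nat := [seq q <- iota 0 n.+1 | prime q].

Definition primorial (n : nat) : nat := (\prod_(q <- primes_upto n) q)%N.

Lemma mem_primes_upto n q : (q \in primes_upto n) = prime q && (q <= n)%N.
Proof. by rewrite mem_filter mem_iota. Qed.

Lemma primes_upto_uniq n : uniq (primes_upto n).
Proof. by rewrite filter_uniq ?iota_uniq. Qed.

Lemma primes_uptoS n :
  primes_upto n.+1 = if prime n.+1 then rcons (primes_upto n) n.+1 else primes_upto n.
Proof.
by rewrite /primes_upto -(addn1 n.+1) iotaD filter_cat /= add0n; case: ifP;
  rewrite ?cats1 ?cats0.
Qed.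

Lemma primorialS_prime n : prime n.+1 -> primorial n.+1 = (n.+1 * primorial n)%N.
Proof. by move=> pr; rewrite /primorial primes_uptoS pr -cats1 big_cat big_seq1 mulnC. Qed.

Lemma primorial_gt0 n : (0 < primorial n)%N.
Proof.
by rewrite /primorial big_seq prodn_cond_gt0 // => q;
  rewrite mem_primes_upto => /andP[/prime_gt0].
Qed.

Lemma prime_ndvd_primorial n p : prime p -> (n < p)%N -> ~~ (p %| primorial n)%N.
Proof.
move=> pr_p np; rewrite /primorial big_seq; elim/big_ind: _ => [|x y Hx Hy|q].
- by rewrite dvdn1 neq_ltn prime_gt1 ?orbT.
- by rewrite Euclid_dvdM // negb_or Hx.
rewrite mem_primes_upto => /andP[pr_q qn]; rewrite dvdn_prime2 //.
by rewrite neq_ltn (leq_ltn_trans qn np) orbT.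
Qed.

Lemma dvdn_prod_primes (s : seq nat) (m : nat) :
  uniq s -> (forall q, q \in s -> prime q && (q %| m))%N -> (\prod_(q <- s) q %| m)%N.
Proof.
elim: s => [|q s IHs] /=; first by rewrite big_nil dvd1n.
case/andP=> qs su sm; rewrite big_cons Gauss_dvd.
  have /andP[_ ->] := sm q (mem_head _ _); apply: IHs => // r rs.
  by apply: sm; rewrite inE rs orbT.
have /andP[pr_q _] := sm q (mem_head _ _).
rewrite prime_coprime // big_seq; elim/big_ind: _ => [|x y Hx Hy|r rs].
- by rewrite dvdn1 neq_ltn prime_gt1 ?orbT.
- by rewrite Euclid_dvdM // negb_or Hx.
have /andP[pr_r _] : prime r && (r %| m)%N by apply: sm; rewrite inE rs orbT.
by rewrite dvdn_prime2 //; apply: contra qs => /eqP->.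
Qed.

Lemma prime_dvd_primorial n q : prime q -> (q <= n)%N -> (q %| primorial n)%N.
Proof.
move=> pr_q qn; rewrite /primorial (big_rem q) ?dvdn_mulr //.
by rewrite mem_primes_upto pr_q.
Qed.

(** * Adding a prime to an interval of sums over products of two primes *)

Definition two_primes_upto (n m : nat) : Prop :=
  exists p q : nat, [/\ prime p, prime q, (q < p <= n)%N & m = (p * q)%N].

Definition filled (P : nat -> Prop) (n : nat) (al be : rat) : Prop :=
  forall M : nat, al <= M%:R / (primorial n)%:R <= be ->
  exists s : seq nat, [/\ uniq s, (forall m, m \in s -> P m) &
    usum s = M%:R / (primorial n)%:R].

(** The witness is [(M - c) / p]; the inequality serves to make [M - c] a genuine difference of
    naturals. *)
Lemma quotient_by_new_prime (p N M c : nat) (y : rat) :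
  (0 < p)%N -> (0 < N)%N -> y = c%:R / N%:R -> c = M %[mod p] ->
  y / p%:R <= M%:R / (p * N)%:R ->
  exists M' : nat, M'%:R / N%:R = M%:R / (p * N)%:R - y / p%:R :> rat.
Proof.
move=> p0 N0 -> cM le.
have pR : 0 < p%:R :> rat by rewrite ltr0n.
have NR : 0 < N%:R :> rat by rewrite ltr0n.
have cleM : (c <= M)%N.
  move: le; rewrite natrM -mulrA -invfM mulrC [(N%:R * _)]mulrC.
  by rewrite [_^-1 * _]mulrC ler_pM2r ?ler_nat // invr_gt0 mulr_gt0.
have /dvdnP[M' E] : (p %| M - c)%N by rewrite -eqn_mod_dvd // cM.
exists M'; have -> : M = (M' * p + c)%N by rewrite -E subnK.
by rewrite natrD !natrM; field; rewrite !gt_eqF.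
Qed.

(** Passing to the complement turns the numerator [c] into [S - c], where [S] is that of all primes
    up to [n]. To get [M], [c] must be [S - M]; since [n] is -1 modulo [n.+1], this is written
    [S + n * M] without subtraction. *)
Lemma usum_primes_upto_residue (n : nat) (s : seq nat) (c M : nat) :
  prime n.+1 -> uniq s -> {subset s <= primes_upto n} ->
  usum s = c%:R / (primorial n)%:R ->
  (c = \sum_(q <- primes_upto n) (primorial n %/ q) + n * M %[mod n.+1])%N ->
  exists s' c', [/\ uniq s', {subset s' <= primes_upto n},
    usum s' = usum (primes_upto n) - usum s,
    usum s' = c'%:R / (primorial n)%:R & c' = M %[mod n.+1]].
Proof.
move=> pr us sU sc cE; set S := (\sum_(q <- _) _)%N in cE.
have sS : usum (primes_upto n) = S%:R / (primorial n)%:R.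
  apply: usum_common_denominator; first exact: primorial_gt0.
  by move=> q; rewrite mem_primes_upto => /andP[? ?]; apply: prime_dvd_primorial.
have NR : 0 < (primorial n)%:R :> rat by rewrite ltr0n primorial_gt0.
have cS : (c <= S)%N.
  have := usum_subset us sU; rewrite sS sc ler_pM2r ?invr_gt0 //.
  by rewrite ler_nat.
exists [seq q <- primes_upto n | q \notin s], (S - c)%N.
have E : usum [seq q <- primes_upto n | q \notin s] = usum (primes_upto n) - usum s.
  by apply: usum_complement; rewrite ?primes_upto_uniq.
split=> //.
- by rewrite filter_uniq ?primes_upto_uniq.
- by move=> q; rewrite mem_filter => /andP[].
- by rewrite E sS sc natrB // mulrBl.
apply/eqP; rewrite -(eqn_modDr (c + n * M)%N).
have -> : (S - c + (c + n * M) = S + n * M)%N by rewrite addnA subnK.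
have -> : (M + (c + n * M) = M * n.+1 + c)%N by rewrite mulnS addnCA addnC [(M * n)%N]mulnC.
by rewrite modnMDl cE.
Qed.

(** Let [y] be the target and [p := n.+1]. If [y <= be], a part of [B] is subtracted, which costs at
    most [w / p]. If [y > be], the complement of a part of [B] is subtracted: this is at least
    [(usum (primes_upto n) - w) / p], enough to get below [be], and at most [be - al], so that [al]
    is not passed. The terms added are multiples of [p] and hence new. *)
Lemma interval2_step (n : nat) (al be w : rat) (B : seq nat) :
  prime n.+1 -> 0 <= al -> uniq B -> {subset B <= primes_upto n} ->
  covers n.+1 B -> usum B <= w ->
  usum (primes_upto n) <= n.+1%:R * (be - al) ->
  filled (two_primes_upto n) n al be ->
  filled (two_primes_upto n.+1) n.+1 (al + w / n.+1%:R)
    (be + (usum (primes_upto n) - w) / n.+1%:R).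
Proof.
move=> pr al0 uB BU cB wB len H M; rewrite primorialS_prime //.
set N := primorial n; set p := n.+1; set y := M%:R / _ => /andP[y1 y2].
have N0 : (0 < N)%N := primorial_gt0 n.
have pR : 0 < p%:R :> rat by rewrite ltr0n.
have w0 : 0 <= w := le_trans (usum_ge0 B) wB.
have pN : ~~ (p %| N)%N by apply: prime_ndvd_primorial.
have BN q : q \in B -> (q %| N)%N.
  by move=> /BU; rewrite mem_primes_upto => /andP[? ?]; apply: prime_dvd_primorial.
suff [s [c [us sU sc cM rng]]] : exists s c, [/\ uniq s, {subset s <= primes_upto n},
    usum s = c%:R / N%:R, c = M %[mod p] & al <= y - usum s / p%:R <= be].
  have [|M' M'E] := quotient_by_new_prime (ltn0Sn n) N0 sc cM.
    by case/andP: rng => h _; rewrite -subr_ge0; apply: le_trans h.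
  rewrite -/y in M'E; rewrite -M'E in rng.
  have [s2 [us2 s2P s2E]] := H M' rng.
  exists (s2 ++ map (muln p) s); split.
  - rewrite cat_uniq us2 map_inj_uniq ?us ?andbT; last first.
      by move=> a b /eqP; rewrite eqn_pmul2l // => /eqP.
    apply/hasPn => _ /mapP[q qs ->]; apply/negP => /s2P[p1 [q1 [pr1 pr2 /andP[h1 h2] E]]].
    have : (p %| p1 * q1)%N by rewrite -E dvdn_mulr.
    rewrite Euclid_dvdM // !dvdn_prime2 // => /orP[] /eqP pE.
      by move: h2; rewrite -pE ltnn.
    by move: (leq_trans h1 (leqW h2)); rewrite -pE ltnn.
  - move=> m; rewrite mem_cat => /orP[/s2P[p1 [q1 [pr1 pr2 /andP[h1 h2] E]]]|].
      by exists p1, q1; rewrite h1 leqW.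
    case/mapP=> q /sU; rewrite mem_primes_upto => /andP[prq qn] ->.
    by exists p, q; rewrite ltnS qn leqnn.
  - by rewrite usum_cat usum_map_mul s2E M'E mulrC subrK.
have [yb|by'] := lerP y be.
  have [s [c [sB sc cM]]] := covers_residue M pr pN BN cB.
  exists s, c; split=> //; first exact: subseq_uniq uB.
    by move=> q /(mem_subseq sB)/BU.
  have sw : usum s <= w.
    by apply: le_trans wB; apply: usum_subset; [exact: subseq_uniq uB|exact: mem_subseq].
  have : usum s / p%:R <= w / p%:R by rewrite ler_pM2r ?invr_gt0.
  have : 0 <= usum s / p%:R by rewrite divr_ge0 ?usum_ge0 ?ltW.
  by move=> ? ?; apply/andP; split; lra.
set S := (\sum_(q <- primes_upto n) (N %/ q))%N.
have [s0 [c0 [s0B s0c c0M]]] := covers_residue (S + n * M) pr pN BN cB.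
have us0 : uniq s0 by apply: subseq_uniq uB.
have s0U : {subset s0 <= primes_upto n} by move=> q /(mem_subseq s0B)/BU.
have [s [c [us sU sE sc cM]]] := usum_primes_upto_residue pr us0 s0U s0c c0M.
exists s, c; split=> //.
have s0w : usum s0 <= w.
  by apply: le_trans wB; apply: usum_subset => //; exact: mem_subseq.
have h1 : (usum (primes_upto n) - w) / p%:R <= usum s / p%:R.
  by rewrite ler_pM2r ?invr_gt0 // sE; lra.
have h2 : usum s / p%:R <= be - al.
  rewrite ler_pdivrMr // mulrC; apply: le_trans len; rewrite sE.
  by have := usum_ge0 s0; lra.
by apply/andP; split; lra.
Qed.

(** * Chebyshev's lower bound *)

Section Chebyshev.
Local Open Scope nat_scope.

(** By Legendre's formula the exponent is a sum of terms [(2 n) %/ q ^ k - 2 (n %/ q ^ k)]. Each is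
    at most 1, and it vanishes once [q ^ k] exceeds [2 n]. *)
Lemma logn_central_binomial (n q : nat) :
  0 < n -> prime q -> q ^ logn q 'C(2 * n, n) <= 2 * n.
Proof.
move=> n0 pr_q; have q1 := prime_gt1 pr_q.
apply: leq_trans (_ : q ^ trunc_log q (2 * n) <= _); last first.
  by apply: trunc_logP => //; rewrite muln_gt0.
rewrite leq_exp2l //; set t := trunc_log q (2 * n).
have bin0 : 0 < 'C(2 * n, n) by rewrite bin_gt0 leq_pmull.
have := bin_fact (leq_pmull n (isT : 0 < 2)).
rewrite (_ : 2 * n - n = n); last by rewrite mul2n -addnn addnK.
move/(congr1 (logn q)); rewrite !lognM ?muln_gt0 ?fact_gt0 // !logn_fact //.
have -> : \sum_(1 <= k < n.+1) n %/ q ^ k = \sum_(1 <= k < (2 * n).+1) n %/ q ^ k.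
  rewrite [RHS](@big_cat_nat _ _ _ n.+1) //= ?ltnS ?leq_pmull //.
  rewrite [X in _ = _ + X]big_nat_cond [X in _ = _ + X]big1 ?addn0 // => k /andP[/andP[nk _] _].
  by rewrite divn_small // (leq_trans nk) // ltnW // ltn_expl.
move=> E; suff le : \sum_(1 <= k < (2 * n).+1) (2 * n) %/ q ^ k <=
    2 * (\sum_(1 <= k < (2 * n).+1) n %/ q ^ k) + t.
  by move: E le; set u := logn _ _; set v := \sum_(1 <= k < _) n %/ _; lia.
apply: (@leq_trans (\sum_(1 <= k < (2 * n).+1) (2 * (n %/ q ^ k) + (k <= t)))).
  rewrite big_nat_cond [leqRHS]big_nat_cond; apply: leq_sum => k /andP[/andP[k1 _] _].
  have qk : 0 < q ^ k by rewrite expn_gt0 ltnW.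
  case: (leqP k t) => kt.
    have lt : 2 * n < (2 * (n %/ q ^ k) + 2) * q ^ k.
      by rewrite -mulnSr -mulnA ltn_pmul2l ?ltn_ceil.
    by move: lt; rewrite -ltn_divLR // addn2 addn1.
  rewrite divn_small // (leq_trans (trunc_log_ltn _ q1)) // leq_exp2l //.
rewrite big_split /= big_distrr /= leq_add2l.
suff: \sum_(1 <= k < (2 * n).+1) (k <= t) <= minn (2 * n) t.
  by move/leq_trans; apply; apply: geq_minr.
elim: (2 * n) => [|m IHm]; first by rewrite big_geq.
by rewrite big_nat_recr //=; move: IHm; set u := \sum_(1 <= k < _) _; lia.
Qed.

Lemma prime_dvd_fact_leq (q n : nat) : prime q -> q %| n`! -> q <= n.
Proof.
move=> pr_q; elim: n => [|n IHn].
  by rewrite fact0 dvdn1 => /eqP q1; rewrite q1 in pr_q.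
rewrite factS Euclid_dvdM // => /orP[/dvdn_leq -> //|/IHn].
exact: leqW.
Qed.

(** From [m] to [m + 1] the central binomial coefficient is multiplied by [2 (2 m + 1) / (m + 1)],
    so the right-hand side grows at least by the factor 4. *)
Lemma central_binomial_ge (n : nat) : 0 < n -> 4 ^ n <= 2 * n * 'C(2 * n, n).
Proof.
case: n => // n _; elim: n => [|n IHn]; first by [].
set m := n.+1 in IHn *.
have E1 : m.+1 * 'C(2 * m.+1, m.+1) = 2 * m.+1 * 'C((2 * m).+1, m).
  by rewrite -mul_bin_diag (_ : (2 * m.+1).-1 = (2 * m).+1) // mulnS.
have E2 : m.+1 * 'C((2 * m).+1, m) = (2 * m).+1 * 'C(2 * m, m).
  rewrite -(bin_sub (n := (2 * m).+1)); last by lia.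
  rewrite (_ : (2 * m).+1 - m = m.+1); last by lia.
  by rewrite -mul_bin_diag.
rewrite -mulnA E1 (_ : 2 * (2 * m.+1 * 'C((2 * m).+1, m)) = 4 * (m.+1 * 'C((2 * m).+1, m)));
  last by lia.
rewrite E2 expnS leq_mul2l /=; apply: leq_trans IHn _.
by rewrite leq_mul2r leqnSn orbT.
Qed.

(** Every prime power in the factorization of the central binomial coefficient is at most [2 n],
    which gives [4 ^ n <= (2 n) ^ (k + 1)] for [k] primes. The number [e] stands for the binary
    logarithm of [2 n], rounded up. *)
Lemma size_primes_upto_ge (n e : nat) :
  0 < n -> 2 * n <= 2 ^ e -> 2 * n <= e * (size (primes_upto (2 * n))).+1.
Proof.
move=> n0 ne; set m := 'C(2 * n, n).
have m0 : 0 < m by rewrite bin_gt0 leq_pmull.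
have mle : m <= (2 * n) ^ size (primes_upto (2 * n)).
  rewrite [leqLHS](prod_prime_decomp m0) prime_decompE big_map /=.
  apply: (@leq_trans (\prod_(q <- primes m) (2 * n))).
    rewrite big_seq [leqRHS]big_seq; elim/big_ind2: _ => // [a b c d ab cd|q].
      exact: leq_mul.
    by rewrite mem_primes => /and3P[pr_q _ _]; apply: logn_central_binomial.
  rewrite big_const_seq count_predT iter_muln_1 leq_exp2l; last by lia.
  apply: uniq_leq_size; first exact: primes_uniq.
  move=> q; rewrite mem_primes mem_primes_upto => /and3P[pr_q _ qm]; rewrite pr_q /=.
  have : q %| (2 * n)`! by rewrite -(bin_fact (leq_pmull n (isT : 0 < 2))) dvdn_mulr.
  exact: prime_dvd_fact_leq.
have : 2 ^ (2 * n) <= 2 ^ (e * (size (primes_upto (2 * n))).+1).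
  rewrite expnM [leqRHS]expnM (leq_trans (central_binomial_ge n0)) //.
  apply: leq_trans (_ : (2 * n) ^ (size (primes_upto (2 * n))).+1 <= _).
    by rewrite expnS leq_mul2l mle orbT.
  by rewrite leq_exp2r.
by rewrite leq_exp2l.
Qed.

End Chebyshev.

(** * Sums of reciprocals of primes *)

Lemma usum_seq1 n : usum [:: n] = (n%:R)^-1.
Proof. exact: big_seq1. Qed.

Lemma usum_iotaS n : usum (iota 1 n.+1) = usum (iota 1 n) + (n.+1%:R)^-1.
Proof. by rewrite -[in LHS](addn1 n) iotaD usum_cat usum_seq1 add1n. Qed.

Lemma usum_primes_uptoS n : prime n.+1 ->
  usum (primes_upto n.+1) = usum (primes_upto n) + (n.+1%:R)^-1.
Proof. by move=> pr; rewrite primes_uptoS pr -cats1 usum_cat usum_seq1. Qed.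

Lemma usum_ge_const (s : seq nat) (b : nat) :
  (forall n, n \in s -> 0 < n <= b)%N -> (size s)%:R / b%:R <= usum s.
Proof.
elim: s => [|n s IHs] sb; first by rewrite mul0r usum_ge0.
have /andP[n0 nb] := sb n (mem_head _ _).
rewrite usum_cons /= -natr1 mulrDl addrC mul1r lerD //.
  by rewrite lef_pV2 ?posrE ?ltr0n ?ler_nat // (leq_trans n0).
by apply: IHs => m ms; apply: sb; rewrite inE ms orbT.
Qed.

Lemma usum_le_const (s : seq nat) (b : nat) :
  (0 < b)%N -> (forall n, n \in s -> b <= n)%N -> usum s <= (size s)%:R / b%:R.
Proof.
move=> b0; elim: s => [|n s IHs] sb; first by rewrite mul0r /usum big_nil.
have nb := sb n (mem_head _ _).
rewrite usum_cons /= -natr1 mulrDl addrC mul1r lerD //.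
  by apply: IHs => m ms; apply: sb; rewrite inE ms orbT.
by rewrite lef_pV2 ?posrE ?ltr0n ?ler_nat // (leq_trans b0).
Qed.

Lemma usum_primes_upto_ge (n m : nat) : (n <= m)%N ->
  usum (primes_upto n) +
    ((size (primes_upto m))%:R - (size (primes_upto n))%:R) / m%:R <=
  usum (primes_upto m).
Proof.
move=> nm; rewrite [primes_upto m](_ : _ = primes_upto n ++
    [seq q <- iota n.+1 (m - n) | prime q]); last first.
  by rewrite /primes_upto -[in LHS](subnKC nm) -addSn iotaD filter_cat.
rewrite usum_cat size_cat natrD addrAC subrr add0r lerD2l.
apply: usum_ge_const => q; rewrite mem_filter mem_iota => /and3P[_ nq].
by rewrite addSn subnKC // ltnS => ->; rewrite (leq_trans _ nq).
Qed.

Lemma usum_iota_ge (k : nat) : k%:R / 2 <= usum (iota 1 (2 ^ k)).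
Proof.
elim: k => [|k IHk]; first by rewrite mul0r usum_ge0.
rewrite expnS mul2n -addnn iotaD usum_cat -natr1 mulrDl lerD //.
apply: le_trans (usum_ge_const (b := (2 ^ k.+1)%N) _).
  rewrite size_iota expnS natrM; move: (2 ^ k)%N (expn_gt0 2 k) => x /= x0.
  have xR : (x%:R : rat) != 0 by rewrite pnatr_eq0 -lt0n.
  by rewrite mul1r invfM mulrCA (divff xR) mulr1.
by move=> n; rewrite mem_iota expnS mul2n -addnn => /andP[h1 h2]; lia.
Qed.

(** The first [m] terms are at most 1 and the others at most [1/m]. This crude bound already shows
    that the harmonic sums are [o(n)], which is what the intervals near 0 require. *)
Lemma usum_iota_le (n m : nat) : (0 < m)%N -> usum (iota 1 n) <= m%:R + n%:R / m%:R.
Proof.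
move=> m0; have mR : 0 < m%:R :> rat by rewrite ltr0n.
suff : usum (iota 1 n) <= (minn n m)%:R + n%:R / m%:R.
  by move/le_trans; apply; rewrite lerD2r ler_nat geq_minr.
elim: n => [|n IHn]; first by rewrite /usum big_nil mul0r addr0 min0n.
rewrite usum_iotaS -[in leRHS]natr1 mulrDl mul1r.
have [nm|mn] := ltnP n m.
  have h1 : (n.+1%:R)^-1 <= 1 :> rat by rewrite invf_le1 ?ler1n ?ltr0n.
  have h2 : 0 <= (m%:R)^-1 :> rat by rewrite invr_ge0 ltW.
  rewrite (minn_idPl _) // -[in leRHS]natr1; rewrite (minn_idPl _) ?(ltnW nm) // in IHn.
  move: h1 h2 IHn; move: (usum _) (n.+1%:R^-1) (m%:R^-1) (n%:R / _) => a b c d.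
  by lra.
have h1 : (n.+1%:R)^-1 <= (m%:R)^-1 :> rat.
  by rewrite lef_pV2 ?posrE ?ltr0n // ler_nat leqW.
by rewrite (minn_idPr _) ?leqW //; rewrite (minn_idPr _) // in IHn;
  move: h1 IHn; move: (usum _) (n.+1%:R^-1) (m%:R^-1) (n%:R / _) => a b c d; lra.
Qed.

Lemma usum_primes_upto_le_iota (n : nat) : usum (primes_upto n) <= usum (iota 1 n).
Proof.
apply: usum_subset; first exact: primes_upto_uniq.
by move=> q; rewrite mem_primes_upto mem_iota add1n ltnS => /andP[/prime_gt0 -> ->].
Qed.

(* Abel summation over dyadic blocks, with [size_primes_upto_ge] on each block. *)
Lemma usum_primes_upto_ge_harmonic (k : nat) :
  (size (primes_upto (2 ^ k.+1)))%:R / (2 ^ k.+1)%:R + usum (iota 1 k) / 2 - 1 / 2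
    + 1 / (2 ^ k.+1)%:R <= usum (primes_upto (2 ^ k.+1)).
Proof.
elim: k => [|k IHk].
  have -> : primes_upto (2 ^ 1) = [:: 2]%N by [].
  rewrite usum_seq1 [usum (iota 1 0)]big_nil expn1 [size _]/=.
  by lra.
have le : (2 ^ k.+1 <= 2 ^ k.+2)%N by rewrite leq_exp2l.
have := usum_primes_upto_ge le; set s := size (primes_upto (2 ^ k.+2)) => H.
have h2 : (2 ^ k.+1 <= k.+1 * (size (primes_upto (2 ^ k.+1))).+1)%N.
  by have := @size_primes_upto_ge (2 ^ k) k.+1; rewrite -expnS expn_gt0; apply.
rewrite usum_iotaS; apply: le_trans H.
set t := size _ in IHk h2 *; set u := usum (primes_upto _) in IHk *.
have xR : 0 < (2 ^ k.+1)%:R :> rat by rewrite ltr0n expn_gt0.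
have E : (2 ^ k.+2)%:R = 2 * (2 ^ k.+1)%:R :> rat by rewrite expnS natrM.
have h3 : (k.+1%:R)^-1 <= (t%:R + 1) / (2 ^ k.+1)%:R :> rat.
  rewrite ler_pdivlMr // mulrC ler_pdivrMr ?ltr0n // natr1 -natrM ler_nat mulnC.
  exact: h2.
rewrite E invfM; set x := ((2 ^ k.+1)%:R)^-1 in IHk h3 *.
move: IHk h3; set a := usum (iota 1 k); set b := (k.+1%:R)^-1; move: (t%:R) (s%:R) => t' s'.
by move=> IHk h3; lra.
Qed.

Lemma usum_primes_upto_unbounded (c : rat) : exists n, c <= usum (primes_upto n).
Proof.
have [k ck] : exists k : nat, 4 * c + 2 <= k%:R.
  have [c0|c0] := lerP 0 (4 * c + 2); last by exists 0%N; exact: ltW.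
  by exists (Num.bound (4 * c + 2)); rewrite ltW // archi_boundP.
exists (2 ^ (2 ^ k).+1)%N; apply: le_trans (usum_primes_upto_ge_harmonic _).
have := usum_iota_ge k; move: (2 ^ k)%N => m; move: (usum _) => u hu.
have aux (a b : rat) : 0 <= a -> 0 <= b -> c <= a + u / 2 - 1 / 2 + b by lra.
by apply: aux; rewrite divr_ge0 ?ler0n.
Qed.

(** * Computed covers for small moduli *)

(* A number encodes a set of residues modulo p by its bits, so that translating by [a]
   is a cyclic shift of p bits. *)
Definition rotate_or (p X a : N) : N :=
  N.lor X (N.lor (N.land (N.shiftl X a) (N.ones p)) (N.shiftr X (p - a))).

Fixpoint euclid_inverse (fuel : nat) (p r0 r1 t0 t1 : N) : N :=
  if fuel is k.+1 then
    if N.eqb r1 0 then t0 else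
    let (q, r) := N.div_eucl r0 r1 in
    euclid_inverse k p r1 r t1 (N.modulo (t0 + (p - N.modulo (q * t1) p)) p)
  else t0.

(* Not proved correct: [reach_step] checks the result instead. *)
Definition inverse_mod (p q : N) : N := euclid_inverse 30 p p q 0 1.

Definition reach_step (p q X : N) : N :=
  let a := inverse_mod p q in
  if N.eqb (N.modulo (a * q) p) 1 && N.leb a p then rotate_or p X a else X.

(** The initial [1] encodes the set of the empty sum 0. Every bit that gets set is a residue reached
    by some sublist of [B]. *)
Definition reach (p : N) (B : seq N) : N := foldr (reach_step p) 1%num B.

Lemma reach_cons p q B : reach p (q :: B) = reach_step p q (reach p B).
Proof. by []. Qed.

Lemma reach_sound (p : N) (B : seq N) (i : N) :
  prime (N.to_nat p) -> N.testbit (reach p B) i ->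
  exists2 s : seq nat, subseq s (map N.to_nat B) &
    \sum_(n <- s) (n%:R)^-1 = (N.to_nat i)%:R :> 'F_(N.to_nat p).
Proof.
move=> pr_p; elim: B i => [|q B IHB] i.
  by case: i => //= _; exists [::] => //; rewrite big_nil.
have keep j : N.testbit (reach p B) j -> exists2 s : seq nat,
    subseq s (map N.to_nat (q :: B)) &
    \sum_(n <- s) (n%:R)^-1 = (N.to_nat j)%:R :> 'F_(N.to_nat p).
  case/IHB=> s sB sE; exists s => //; apply: subseq_trans sB _; exact: subseq_cons.
rewrite reach_cons /reach_step.
move: (inverse_mod p q) (reach p B) IHB keep => a X IHB keep.
case: ifP => [/andP[/N.eqb_eq aq /N.leb_le ap]|_]; last exact: keep.
have pF : (N.to_nat p)%:R = 0 :> 'F_(N.to_nat p) by rewrite pchar_Fp_0.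
have aqF : (N.to_nat a)%:R * (N.to_nat q)%:R = 1 :> 'F_(N.to_nat p).
  have p0 : p <> 0%num by move=> p0; rewrite p0 in pr_p.
  have E : (N.to_nat a * N.to_nat q = N.to_nat p * N.to_nat (a * q / p)%num + 1)%N.
    have := N.div_mod (a * q) p p0; rewrite aq; lia.
  by rewrite -natrM E natrD natrM pF mul0r add0r.
have aF : ((N.to_nat q)%:R : 'F_(N.to_nat p))^-1 = (N.to_nat a)%:R.
  have q0 : (N.to_nat q)%:R != 0 :> 'F_(N.to_nat p).
    by apply/eqP => q0; move/eqP: aqF; rewrite q0 mulr0 eq_sym oner_eq0.
  by apply: (mulIf q0); rewrite mulVf // aqF.
have add j : N.testbit X j -> exists2 s : seq nat, subseq s (map N.to_nat (q :: B)) &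
    \sum_(n <- s) (n%:R)^-1 = (N.to_nat j + N.to_nat a)%:R :> 'F_(N.to_nat p).
  case/IHB=> s sB sE; exists (N.to_nat q :: s); first by rewrite /= eqxx.
  by rewrite big_cons sE aF natrD addrC.
(* A set bit is an old one, one moved up by [a], or one moved up by [a] and reduced by [p], that is,
   moved down by [p - a]. In the last two cases the inverse [a] of [q] has been added. *)
rewrite /rotate_or !N.lor_spec N.land_spec => /or3P[|/andP[+ _]|].
- exact: keep.
- case: (N.ltb_spec i a) => [ia|ai]; first by rewrite N.shiftl_spec_low.
  rewrite N.shiftl_spec_high' // => /add[s sB sE]; exists s => //.
  by rewrite [LHS]sE; congr (_%:R); lia.
rewrite N.shiftr_spec' => /add[s sB sE]; exists s => //; rewrite [LHS]sE.
have -> : (N.to_nat (i + (p - a)) + N.to_nat a = N.to_nat i + N.to_nat p)%N by lia.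
by rewrite natrD pF addr0.
Qed.

Lemma covers_reach (p : N) (B : seq N) :
  prime (N.to_nat p) -> reach p B = N.ones p -> covers (N.to_nat p) (map N.to_nat B).
Proof.
move=> pr_p E t.
have tp : (t < N.to_nat p)%N by rewrite -[X in (_ < X)%N](Fp_cast pr_p).
have [|s sB sE] := @reach_sound p B (N.of_nat t) pr_p.
  by rewrite E N.ones_spec_low //; lia.
exists s => //; rewrite sE Nat2N.id; exact: natr_Zp.
Qed.

Definition small_primes : seq N :=
  [:: 2; 3; 5; 7; 11; 13; 17; 19; 23; 29; 31; 37; 41; 43; 47; 53; 59; 61]%num.

Definition trial_division (n : N) : bool :=
  all (fun d => N.ltb n (d * d) || negb (N.eqb (N.modulo n d) 0)) small_primes.

Lemma mod_dvdn (n d : N) : d <> 0%num -> (N.modulo n d = 0)%num <->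
  (N.to_nat d %| N.to_nat n)%N.
Proof.
move=> d0; split=> [H|/dvdnP[k E]].
  apply/dvdnP; exists (N.to_nat (n / d)%num).
  by have := N.div_mod n d d0; rewrite H; lia.
have -> : n = (N.of_nat k * d)%num by lia.
by rewrite N.Div0.mod_mul.
Qed.

(** A composite number below [4096 = 64 ^ 2] has a prime divisor below 64 whose square does not
    exceed it, and [small_primes] lists all primes below 64. The escape [n < d * d] keeps a listed
    prime from being rejected by itself. *)
Lemma trial_divisionP (n : nat) : (1 < n < 4096)%N ->
  trial_division (N.of_nat n) = prime n.
Proof.
move=> /andP[n1 n2]; apply/idP/idP => [/allP H|pr_n].
  apply: contraT => npr.
  have /andP[pr_d dn] : prime (pdiv n) && (pdiv n %| n)%N by rewrite pdiv_prime ?pdiv_dvd.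
  have dd : (pdiv n ^ 2 <= n)%N.
    by rewrite leqNgt; apply: contra npr; apply: ltn_pdiv2_prime; apply: ltnW.
  have d64 : (pdiv n < 64)%N by rewrite -(ltn_exp2r _ _ (isT : 0 < 2)%N) (leq_ltn_trans dd).
  have dS : N.of_nat (pdiv n) \in small_primes.
    move: (pdiv n) d64 pr_d => d; clear.
    have: all (fun d => prime d ==> (N.of_nat d \in small_primes)) (iota 0 64) by [].
    by move/allP/(_ d); rewrite mem_iota => H dl; apply/implyP/H.
  have := H _ dS; case/orP=> [/N.ltb_lt|/negP[]]; first by lia.
  apply/N.eqb_eq; apply/mod_dvdn; last by rewrite !Nat2N.id.
  by have := prime_gt0 pr_d; lia.
apply/allP => d dS; apply/orP.
case: (N.ltb_spec (N.of_nat n) (d * d)) => [|ddn]; [by left|right].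
apply/negP => /N.eqb_eq.
have d1 : (1 < N.to_nat d)%N.
  have: all (fun d => 1 < N.to_nat d)%N small_primes by [].
  by move/allP/(_ d dS).
move/mod_dvdn; rewrite Nat2N.id => /(_ _)/prime_nt_dvdP H.
have E : N.to_nat d = n by apply: H => //; lia.
have : (N.to_nat d * N.to_nat d <= n)%N by lia.
by rewrite E leqNgt ltn_Pmull // ltnW.
Qed.

(** Reciprocals are rounded down or up to multiples of [1 / scale], so that inequalities between
    sums become comparisons of integers. *)
Definition scale : N := 1000000.

Definition floor_sum (K : N) (s : seq N) : N :=
  foldr (fun q a => N.add (N.div K q) a) 0%num s.

Definition ceil_sum (K : N) (s : seq N) : N :=
  foldr (fun q a => N.add (N.add (N.div K q) 1) a) 0%num s.

Lemma floor_sum_le (K : N) (s : seq N) : K <> 0%num -> (forall q, q \in s -> q <> 0%num) ->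
  (N.to_nat (floor_sum K s))%:R / (N.to_nat K)%:R <= usum (map N.to_nat s).
Proof.
move=> K0; have KR : 0 < (N.to_nat K)%:R :> rat by rewrite ltr0n; lia.
elim: s => [|q s IHs] s0; first by rewrite mul0r usum_ge0.
rewrite map_cons usum_cons.
rewrite [floor_sum _ _]/= N2Nat.inj_add natrD mulrDl lerD //; last first.
  by apply: IHs => r rs; apply: s0; rewrite inE rs orbT.
have q0 : q <> 0%num by apply: s0; rewrite mem_head.
have qR : 0 < (N.to_nat q)%:R :> rat by rewrite ltr0n; lia.
rewrite ler_pdivrMr ?KR // mulrC ler_pdivlMr // -natrM ler_nat.
by have := N.div_mod K q q0; move: (N.div K q) (N.modulo K q) => a b; nia.
Qed.

Lemma ceil_sum_ge (K : N) (s : seq N) : K <> 0%num -> (forall q, q \in s -> q <> 0%num) ->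
  usum (map N.to_nat s) <= (N.to_nat (ceil_sum K s))%:R / (N.to_nat K)%:R.
Proof.
move=> K0; have KR : 0 < (N.to_nat K)%:R :> rat by rewrite ltr0n; lia.
elim: s => [|q s IHs] s0; first by rewrite mul0r /usum big_nil.
rewrite map_cons usum_cons.
rewrite [ceil_sum _ _]/= N2Nat.inj_add natrD mulrDl lerD //; last first.
  by apply: IHs => r rs; apply: s0; rewrite inE rs orbT.
have q0 : q <> 0%num by apply: s0; rewrite mem_head.
have qR : 0 < (N.to_nat q)%:R :> rat by rewrite ltr0n; lia.
rewrite ler_pdivlMr ?KR // mulrC ler_pdivrMr // -natrM ler_nat.
have := N.div_mod K q q0; have := N.mod_lt K q q0.
by move: (N.div K q) (N.modulo K q) => a b; nia.
Qed.

(* The bound by half of the total makes the loss at the lower end of the interval in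
   [interval2_step] at most the gain at its upper end. *)
Definition light_cover (n : nat) : Prop :=
  exists B : seq nat, [/\ uniq B, {subset B <= primes_upto n}, covers n.+1 B,
    usum B <= 1 & 2 * usum B <= usum (primes_upto n)].

(* At most 15 of the largest primes below p suffice; 2 and 3 are left out as too heavy. *)
Definition check_cover (p : N) (prev : seq N) : bool :=
  let B := take (minn (if N.ltb p 127 then 9 else 15) (size prev - 2)) prev in
  [&& N.eqb (reach p B) (N.ones p), N.leb (ceil_sum scale B) scale &
      N.leb (2 * ceil_sum scale B) (floor_sum scale prev)].

Fixpoint check_covers (k : nat) (n : N) (prev : seq N) : bool :=
  if k is k'.+1 then
    if trial_division n then check_cover n prev && check_covers k' (N.succ n) (n :: prev)
    else check_covers k' (N.succ n) prev
  else true.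

Definition primes_below (n : N) (prev : seq N) : Prop :=
  uniq prev /\ forall q, q \in prev -> prime (N.to_nat q) && N.ltb q n.

Lemma check_cover_sound (n : nat) (prev : seq N) :
  prime n.+1 -> primes_below (N.of_nat n.+1) prev ->
  check_cover (N.of_nat n.+1) prev -> light_cover n.
Proof.
move=> pr [up pp]; rewrite /check_cover; set B := take _ _.
have K0 : scale <> 0%num by [].
move: scale K0 => K K0; have KR : 0 < (N.to_nat K)%:R :> rat by rewrite ltr0n; lia.
case/and3P=> /N.eqb_eq cB /N.leb_le B1 /N.leb_le B2.
have Bp : {subset B <= prev} := @mem_take _ _ _.
have uB : uniq B by rewrite take_uniq.
have q0 q : q \in prev -> q <> 0%num.
  by move/pp/andP => [pq _] q0; rewrite q0 in pq.
have toU (s : seq N) : {subset s <= prev} -> {subset map N.to_nat s <= primes_upto n}.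
  move=> sp _ /mapP[q /sp/pp/andP[pq /N.ltb_lt qn] ->].
  by rewrite mem_primes_upto pq; lia.
exists (map N.to_nat B); split.
- by rewrite map_inj_uniq // => a b; lia.
- exact: toU.
- by have := @covers_reach (N.of_nat n.+1) B; rewrite Nat2N.id; apply.
- apply: le_trans (ceil_sum_ge K0 _) _ => [q /Bp/q0 //|].
  rewrite ler_pdivrMr ?KR // mul1r ler_nat.
  by move: B1; move: (ceil_sum K B) => b; lia.
apply: (@le_trans _ _ (usum (map N.to_nat prev))); last first.
  apply: usum_subset; last exact: toU.
  by rewrite map_inj_uniq // => a b; lia.
apply: le_trans (floor_sum_le K0 q0).
apply: le_trans (_ : 2 * ((N.to_nat (ceil_sum K B))%:R / (N.to_nat K)%:R) <= _).
  by rewrite ler_pM2l //; apply: (ceil_sum_ge K0) => q /Bp/q0.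
rewrite mulrA ler_pM2r ?invr_gt0 ?KR // -natrM ler_nat.
by move: B2; move: (floor_sum K prev) (ceil_sum K B) => a b; lia.
Qed.

Lemma check_covers_sound (k m n : nat) (prev : seq N) :
  (1 < m)%N -> (m + k <= 4096)%N -> primes_below (N.of_nat m) prev ->
  check_covers k (N.of_nat m) prev -> prime n.+1 -> (m <= n.+1 < m + k)%N ->
  light_cover n.
Proof.
elim: k m prev => [|k IHk] m prev m1 mk below; first by lia.
move=> H pr rng; move: H; rewrite /= trial_divisionP; last by lia.
have succE : N.succ (N.of_nat m) = N.of_nat m.+1 by lia.
have wk : primes_below (N.of_nat m.+1) prev.
  split; first by case: below.
  by move=> q /(below.2)/andP[-> /N.ltb_lt ?]; apply/N.ltb_lt; lia.
case: (eqVneq m n.+1) => [mE|mn].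
  by rewrite mE pr => /andP[H _]; apply: check_cover_sound H; rewrite // -mE.
rewrite succE; case: ifP => pm; last first.
  by move=> H; apply: IHk (wk) H pr _; lia.
move=> /andP[_ H]; apply: IHk _ H pr _; try lia.
split.
  rewrite /= (below.1) andbT; apply/negP => /(below.2)/andP[_ /N.ltb_lt]; lia.
move=> q; rewrite inE => /orP[/eqP->|/(wk.2) //].
by rewrite Nat2N.id pm; apply/N.ltb_lt; lia.
Qed.

Lemma light_cover_small (n : nat) : prime n.+1 -> (22 <= n < 1023)%N -> light_cover n.
Proof.
move=> pr rng.
have below : primes_below (N.of_nat 23) [:: 19; 17; 13; 11; 7; 5; 3; 2]%num.
  split=> // q; suff /allP/(_ q) : all (fun q => prime (N.to_nat q) && N.ltb q 23)
    [:: 19; 17; 13; 11; 7; 5; 3; 2]%num by [].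
  by [].
have check : check_covers 1001 23 [:: 19; 17; 13; 11; 7; 5; 3; 2]%num.
  by vm_cast_no_check (erefl true).
by apply: check_covers_sound below check pr _; lia.
Qed.

Fixpoint prime_range (k : nat) (n : N) : seq N :=
  if k is k'.+1 then
    if trial_division n then n :: prime_range k' (N.succ n) else prime_range k' (N.succ n)
  else [::].

Lemma mem_prime_range (k m : nat) (q : N) :
  (1 < m)%N -> (m + k <= 4096)%N -> q \in prime_range k (N.of_nat m) ->
  prime (N.to_nat q) && (m <= N.to_nat q < m + k)%N.
Proof.
elim: k m => [|k IHk] m m1 mk //=.
have succE : N.succ (N.of_nat m) = N.of_nat m.+1 by lia.
rewrite succE trial_divisionP; last by lia.
have rec : q \in prime_range k (N.of_nat m.+1) ->
    prime (N.to_nat q) && (m <= N.to_nat q < m + k.+1)%N.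
  move=> qs; have m1' : (1 < m.+1)%N by lia.
    have mk' : (m.+1 + k <= 4096)%N by lia.
    by case/andP: (IHk _ m1' mk' qs) => -> ?; lia.
by case: ifP => // pm; rewrite inE => /orP[/eqP->|//]; rewrite Nat2N.id pm; lia.
Qed.

Lemma prime_range_uniq (k m : nat) :
  (1 < m)%N -> (m + k <= 4096)%N -> uniq (prime_range k (N.of_nat m)).
Proof.
elim: k m => [|k IHk] m m1 mk //=.
have succE : N.succ (N.of_nat m) = N.of_nat m.+1 by lia.
rewrite succE; case: ifP => _; last by apply: IHk; lia.
rewrite cons_uniq IHk ?andbT; try lia.
apply/negP => /mem_prime_range/andP[]; try lia.
Qed.

(** From here on [usum B <= 1] implies the second bound in [light_cover]. *)
Lemma usum_primes_upto_ge2 (n : nat) : (1023 <= n)%N -> 2 <= usum (primes_upto n).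
Proof.
move=> n1; set s := prime_range 1021 2.
have sP q : q \in s -> prime (N.to_nat q) && (2 <= N.to_nat q < 2 + 1021)%N.
  exact: (@mem_prime_range 1021 2).
have su : uniq s by exact: (@prime_range_uniq 1021 2).
have ge : N.leb (2 * scale) (floor_sum scale s) by vm_cast_no_check (erefl true).
clearbody s.
have q0 q : q \in s -> q <> 0%num by move=> /sP/andP[pq _] q0; rewrite q0 in pq.
apply: (@le_trans _ _ (usum (map N.to_nat s))); last first.
  apply: usum_subset => [|_ /mapP[q /sP/andP[pq ?] ->]].
    by rewrite map_inj_uniq // => a b; lia.
  by rewrite mem_primes_upto pq; lia.
have K0 : scale <> 0%num by [].
move: scale K0 ge => K K0 /N.leb_le ge.
apply: le_trans (floor_sum_le K0 q0); rewrite ler_pdivlMr ?ltr0n; last by lia.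
by rewrite -natrM ler_nat; lia.
Qed.

(** One fixed set, the primes in [[32, 32 + k)], serves for a whole range of moduli: in [covers_odd]
    the modulus enters the numerical conditions on [M], [t1], [t2], [t3] only through [4 p <= t2 M],
    so the upper end [hi] of the range is tested. Small primes are omitted to keep the sum of
    reciprocals at most 1. *)
Definition check_range (k : nat) (hi M t1 t2 t3 : N) : bool :=
  let s := prime_range k 32 in
  [&& N.leb (M + (t1 + t2 + t3)) (N.of_nat (size s)), N.leb (2 ^ t1 * M) (3 ^ t1),
      N.leb (4 * hi) (t2 * M), N.leb M (2 ^ t3) & N.leb (ceil_sum scale s) scale].

Lemma expn_N2Nat (a b : N) : N.to_nat (a ^ b) = (N.to_nat a ^ N.to_nat b)%N.
Proof. by rewrite N2Nat.inj_pow; elim: (N.to_nat b) => //= k ->; rewrite expnS. Qed.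

Lemma light_cover_range (k n : nat) (hi M t1 t2 t3 : N) :
  prime n.+1 -> (32 + k <= 4096)%N -> (0 < M)%num -> check_range k hi M t1 t2 t3 ->
  (1023 <= n)%N -> (32 + k <= n.+1 <= N.to_nat hi)%N -> light_cover n.
Proof.
move=> pr k4 M0; rewrite /check_range; set s := prime_range k 32.
case/and5P=> /N.leb_le c1 /N.leb_le c2 /N.leb_le c3 /N.leb_le c4 /N.leb_le c5 n1 rng.
have sP q : q \in s -> prime (N.to_nat q) && (32 <= N.to_nat q < 32 + k)%N.
  exact: (@mem_prime_range k 32).
have su : uniq s by exact: (@prime_range_uniq k 32).
have tu : uniq (map N.to_nat s) by rewrite map_inj_uniq // => a b; lia.
have s1 : usum (map N.to_nat s) <= 1.
  have K0 : scale <> 0%num by [].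
  move: scale K0 c5 => K K0 c5; apply: le_trans (ceil_sum_ge K0 _) _ => [q /sP|].
    by lia.
  by rewrite ler_pdivrMr ?ltr0n ?mul1r ?ler_nat; lia.
exists (map N.to_nat s); split=> //.
- move=> _ /mapP[q /sP/andP[pq ?] ->].
  by rewrite mem_primes_upto pq; lia.
- apply: (@covers_odd n.+1 (N.to_nat M) (N.to_nat t1) (N.to_nat t2) (N.to_nat t3)) => //.
  + move=> _ /mapP[q /sP/andP[pq ?] ->]; apply/andP; split; last by lia.
    by case: (even_prime pq) => // qE; lia.
  + by lia.
  + by rewrite size_map; move: c1; set z := size s; lia.
  + by have := expn_N2Nat 2 t1; have := expn_N2Nat 3 t1; move=> <- <-; lia.
  + by lia.
  + by have := expn_N2Nat 2 t3; move=> <-; lia.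
  + by lia.
by have := usum_primes_upto_ge2 n1; lra.
Qed.

(** These five checks divide up the moduli from 1024 to 16384. Each uses the primes from 32 to about
    the lower end of its range. *)
Lemma check_range_1201 : check_range 992 1201 80 11 61 7.
Proof. by vm_cast_no_check (erefl true). Qed.

Lemma check_range_1501 : check_range 1168 1501 92 12 66 7.
Proof. by vm_cast_no_check (erefl true). Qed.

Lemma check_range_2049 : check_range 1468 2049 114 12 72 7.
Proof. by vm_cast_no_check (erefl true). Qed.

Lemma check_range_4097 : check_range 2016 4097 149 13 111 8.
Proof. by vm_cast_no_check (erefl true). Qed.

Lemma check_range_17000 : check_range 4064 17000 276 14 247 9.
Proof. by vm_cast_no_check (erefl true). Qed.

Lemma light_cover_mid (n : nat) : prime n.+1 -> (1023 <= n < 64 * 256)%N -> light_cover n.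
Proof.
move=> pr /andP[n1 n2].
case: (leqP n 1199) => h1201.
  by apply: (@light_cover_range 992 n 1201 80 11 61 7 pr _ _ check_range_1201 n1 _); lia.
case: (leqP n 1499) => h1501.
  by apply: (@light_cover_range 1168 n 1501 92 12 66 7 pr _ _ check_range_1501 n1 _); lia.
case: (leqP n 2047) => h2049.
  by apply: (@light_cover_range 1468 n 2049 114 12 72 7 pr _ _ check_range_2049 n1 _); lia.
case: (leqP n 4095) => h4097.
  by apply: (@light_cover_range 2016 n 4097 149 13 111 8 pr _ _ check_range_4097 n1 _); lia.
by apply: (@light_cover_range 4064 n 17000 276 14 247 9 pr _ _ check_range_17000 n1 _); lia.
Qed.

(** * Covers for large moduli *)

(** The map [r.-1./2] is injective on primes, 2 going to 0, and sends the [j] primes dropped, which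
    are below [q], to numbers below [q./2]. *)
Lemma drop_primes_upto_ge (n j q : nat) :
  q \in drop j (primes_upto n) -> (2 * j <= q)%N.
Proof.
move=> qd; have js : (j <= size (primes_upto n))%N.
  by rewrite leqNgt; apply/negP => /ltnW H; rewrite drop_oversize in qd.
have below r : r \in take j (primes_upto n) -> prime r && (r < q)%N.
  move=> rt; have : r \in primes_upto n by apply: mem_take rt.
  rewrite mem_primes_upto => /andP[-> _] /=.
  have : sorted ltn (primes_upto n).
    by apply: sorted_filter; [exact: ltn_trans|exact: iota_ltn_sorted].
  rewrite sorted_pairwise; last exact: ltn_trans.
  rewrite -[X in pairwise _ X](cat_take_drop j) pairwise_cat.
  by case/and3P=> /allrelP H _ _; apply: H.
have sz : size (take j (primes_upto n)) = j by rewrite size_takel.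
have : (j <= size (iota 0 q./2))%N.
  rewrite -sz -(size_map (fun r => r.-1./2)); apply: uniq_leq_size.
    rewrite map_inj_in_uniq ?take_uniq ?primes_upto_uniq //.
    move=> a b /below/andP[pa _] /below/andP[pb _].
    have [a2|oa] := even_prime pa; have [b2|ob] := even_prime pb.
    - by rewrite a2 b2.
    - by have := prime_gt1 pb; lia.
    - by have := prime_gt1 pa; lia.
    by have := prime_gt1 pa; have := prime_gt1 pb; lia.
  move=> _ /mapP[r /below/andP[pr rq] ->]; rewrite mem_iota /=.
  by have := prime_gt1 pr; lia.
by rewrite size_iota; lia.
Qed.

Lemma exists_sqrt64 (p : nat) : (64 * 256 < p)%N ->
  exists v, [/\ (16 <= v)%N, (64 * v ^ 2 < p)%N & (p <= 64 * v.+1 ^ 2)%N].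
Proof.
move=> p1; have ex : exists u, (p <= 64 * u ^ 2)%N by exists p; nia.
case: (ex_minnP ex) => [[|v]]; first by lia.
move=> H1 H2; exists v; split=> //.
  by rewrite leqNgt; apply/negP => v16; nia.
by rewrite ltnNge; apply/negP => /H2; rewrite ltnn.
Qed.

Lemma expn2_ge_square (v : nat) : (16 <= v)%N -> (64 * v.+1 ^ 2 <= 2 ^ v)%N.
Proof.
move=> v16; rewrite -(subnK v16); move: (v - 16)%N => d {v v16}.
elim: d => [|d IHd]; first by rewrite add0n (_ : 2 ^ 16 = 2 ^ 8 * 2 ^ 8)%N.
by rewrite addSn [(2 ^ _.+1)%N]expnS; move: IHd; rewrite -!mulnn; move: (2 ^ _)%N => x; nia.
Qed.

(** Here [e] is the binary logarithm of [n] rounded up. Since [n.+1] is an odd prime, [n] is even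
    and Chebyshev's bound applies to it directly. *)
Lemma size_primes_upto_prime (n v : nat) :
  prime n.+1 -> (16 <= v)%N -> (64 * v ^ 2 < n.+1)%N -> (n.+1 <= 64 * v.+1 ^ 2)%N ->
  exists e, [/\ (64 * v ^ 2 <= e * (size (primes_upto n)).+1)%N, (e <= v)%N &
    (2 ^ e <= 128 * v.+1 ^ 2)%N].
Proof.
move=> pr v16 n1 n2; set e := up_log 2 n.
have n0 : (1 < n)%N by nia.
have ne : (n <= 2 ^ e)%N by exact: up_logP.
have e1 : (2 ^ e.-1 < n)%N by exact: up_log_gtn.
have e0 : (0 < e)%N by rewrite up_log_gt0 n0.
exists e; split.
- have nE : n = (2 * n./2)%N.
    by case: (even_prime pr); lia.
  have m0 : (0 < n./2)%N by lia.
  have := @size_primes_upto_ge n./2 e m0; rewrite -nE => /(_ ne).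
  by apply: leq_trans.
- have : (2 ^ e.-1 < 2 ^ v)%N.
    by apply: leq_trans (expn2_ge_square v16); apply: leq_trans n2; rewrite ltnW.
  by rewrite ltn_exp2l //; lia.
by rewrite -(prednK e0) expnS; move: e1; move: (2 ^ _)%N => x; lia.
Qed.

(** The largest primes are taken because they are the lightest. With [u := v.+1], the number
    [36 u = 18 u + 2 u + 15 u + u] is what [covers_odd] consumes in [covers_top_primes]. *)
Definition top_primes (n v : nat) : seq nat :=
  drop (size (primes_upto n) - 36 * v.+1) (primes_upto n).

Lemma mem_top_primes (n v q : nat) : q \in top_primes n v ->
  q \in primes_upto n /\ (2 * (size (primes_upto n) - 36 * v.+1) <= q)%N.
Proof. by move=> qt; split; [apply: mem_drop qt | apply: drop_primes_upto_ge qt]. Qed.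

Lemma top_primes_uniq (n v : nat) : uniq (top_primes n v).
Proof. by rewrite drop_uniq ?primes_upto_uniq. Qed.

Lemma size_top_primes (n v : nat) : (36 * v.+1 <= size (primes_upto n))%N ->
  size (top_primes n v) = (36 * v.+1)%N.
Proof. by move=> h; rewrite size_drop subKn. Qed.

Lemma covers_top_primes (n v : nat) :
  prime n.+1 -> (16 <= v)%N -> (n.+1 <= 64 * v.+1 ^ 2)%N ->
  (36 * v.+1 + 2 <= size (primes_upto n))%N -> covers n.+1 (top_primes n v).
Proof.
move=> pr v16 n2 sz; set u := v.+1 in n2 sz *.
have u2 : (18 * u <= 2 ^ u)%N.
  rewrite /u -(subnK v16); move: (v - 16)%N => d; elim: d => [|d IHd].
    by rewrite add0n (_ : 2 ^ 17 = 2 ^ 9 * 2 ^ 8)%N.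
  by rewrite addSn expnS; move: IHd; move: (2 ^ _)%N => x; lia.
(* The three conditions read [4 ^ u * 18 u <= 8 ^ u <= 9 ^ u], [4 p <= 256 u ^ 2 <= 270 u ^ 2] and
   [18 u <= 2 ^ u]. *)
apply: (@covers_odd n.+1 (18 * u) (2 * u) (15 * u) u) => //.
- exact: top_primes_uniq.
- move=> q /mem_top_primes[]; rewrite mem_primes_upto -/u => /andP[pq qn] qge.
  (* At least two primes are dropped, so every remaining [q] is at least 4 and therefore odd. *)
  by rewrite ltnS qn andbT; case: (even_prime pq) => // q2; lia.
- rewrite size_top_primes; first by rewrite /u; lia.
  by rewrite -/u; lia.
- rewrite !expnM -[(2 ^ 2)%N]/4%N -[(3 ^ 2)%N]/9%N.
  apply: (@leq_trans (4 ^ u * 2 ^ u)); first by rewrite leq_mul2l u2 orbT.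
  by rewrite -expnMn leq_exp2r.
- by nia.
have := count_size prime (iota 0 n.+1); rewrite size_iota -size_filter.
by rewrite -/(primes_upto n); lia.
Qed.

(** Since [e <= v], there are at least [64 v - 1] primes up to [n]. Dropping all but the top
    [36 (v + 1)] leaves only primes of size at least [36 (v + 1)], whose reciprocals sum to at most
    1. *)
Lemma light_cover_large (n : nat) : prime n.+1 -> (64 * 256 <= n)%N -> light_cover n.
Proof.
move=> pr n1; have [|v [v16 v1 v2]] := @exists_sqrt64 n.+1; first by [].
have [e [he ev _]] := size_primes_upto_prime pr v16 v1 v2.
have k64 : (64 * v <= (size (primes_upto n)).+1)%N.
  have : (v * (64 * v) <= v * (size (primes_upto n)).+1)%N.
    apply: (@leq_trans (e * (size (primes_upto n)).+1)); last by rewrite leq_mul2r ev orbT.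
    by apply: leq_trans he; lia.
  by rewrite leq_pmul2l //; lia.
have sz : (36 * v.+1 + 2 <= size (primes_upto n))%N by lia.
have T1 : usum (top_primes n v) <= 1.
  set b := (2 * (size (primes_upto n) - 36 * v.+1))%N.
  have b0 : (0 < b)%N by rewrite /b; lia.
  have bT q : q \in top_primes n v -> (b <= q)%N by case/mem_top_primes.
  apply: le_trans (usum_le_const b0 bT) _.
  rewrite ler_pdivrMr ?ltr0n // mul1r ler_nat size_top_primes; last by lia.
  by rewrite /b; lia.
exists (top_primes n v); split=> //.
- exact: top_primes_uniq.
- by move=> q /mem_top_primes[].
- exact: covers_top_primes.
have : 2 <= usum (primes_upto n) by apply: usum_primes_upto_ge2; lia.
by lra.
Qed.

Lemma light_coverP (n : nat) : prime n.+1 -> (22 <= n)%N -> light_cover n.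
Proof.
move=> pr n22; case: (leqP 1023 n) => n1; last by apply: light_cover_small; rewrite ?n22.
case: (leqP (64 * 256) n) => n2; first exact: light_cover_large.
by apply: light_cover_mid; rewrite ?n1.
Qed.

(** * The starting interval *)

(** The set bits are the subset sums of the quotients [K / d], that is, the numerators over [K] of
    the sums of distinct [1/d]. *)
Definition divisor_sums (K : N) (L : seq N) : N :=
  foldr (fun d X => N.lor X (N.shiftl X (N.div K d))) 1%num L.

Lemma divisor_sums_sound (K : N) (L : seq N) (i : N) : N.testbit (divisor_sums K L) i ->
  exists2 s : seq N, subseq s L & i = foldr (fun d a => N.add (N.div K d) a) 0%num s.
Proof.
elim: L i => [|d L IHL] i; first by case: i => //= _; exists [::].
rewrite /= N.lor_spec; case/orP => [/IHL[s sL ->]|].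
  by exists s => //; apply: subseq_trans sL (subseq_cons _ _).
case: (N.ltb_spec i (N.div K d)) => [it|ti]; first by rewrite N.shiftl_spec_low.
rewrite N.shiftl_spec_high' // => /IHL[s sL E]; exists (d :: s); first by rewrite /= eqxx.
by rewrite /= -E; lia.
Qed.

Lemma filled_of_run (n : nat) (K a len : N) (L : seq N) (al be : rat) :
  primorial n = N.to_nat K -> uniq L ->
  (forall d, d \in L -> two_primes_upto n (N.to_nat d) /\ N.modulo K d = 0%num) ->
  (forall M : N, al <= (N.to_nat M)%:R / (N.to_nat K)%:R <= be -> (a <= M < a + len)%num) ->
  N.land (N.shiftr (divisor_sums K L) a) (N.ones len) = N.ones len ->
  filled (two_primes_upto n) n al be.
Proof.
move=> PK uL LP rngP run M; rewrite PK -(Nat2N.id M); move: (N.of_nat M) => {}M.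
move=> /rngP[M1 M2].
have : N.testbit (divisor_sums K L) M.
  have := N.ones_spec_low len (M - a); rewrite -run.
  rewrite N.land_spec N.shiftr_spec' (_ : M - a + a = M)%num; last by lia.
  by move=> H; case/andP: (H ltac:(lia)).
case/divisor_sums_sound => s sL ME.
exists (map N.to_nat s); split.
- rewrite map_inj_uniq => [|b c]; last by lia.
  exact: subseq_uniq sL uL.
- by move=> m /mapP[d /(mem_subseq sL)/LP[? _] ->].
rewrite ME.
have {}LP d : d \in s -> N.modulo K d = 0%num by move/(mem_subseq sL)/LP=> [].
have K0 : K <> 0%num.
  by move=> K0; move: (primorial_gt0 n); rewrite PK K0.
elim: s {sL ME} LP => [|d s IHs] LP; first by rewrite mul0r /usum big_nil.
rewrite map_cons usum_cons [foldr _ _ _]/= N2Nat.inj_add natrD mulrDl -IHs; last first.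
  by move=> e es; apply: LP; rewrite inE es orbT.
congr (_ + _).
have E := LP d (mem_head _ _).
have d0 : d <> 0%num by move=> d0; rewrite d0 in E; case: K K0 E {PK rngP run LP IHs}.
have KE := N.div_mod K d d0; rewrite E N.add_0_r in KE.
have KR : (N.to_nat K)%:R != 0 :> rat by rewrite pnatr_eq0; lia.
have dR : (N.to_nat d)%:R != 0 :> rat by rewrite pnatr_eq0; lia.
have KM : (N.to_nat K)%:R = (N.to_nat d)%:R * (N.to_nat (K / d))%:R :> rat.
  by rewrite -natrM {1}KE N2Nat.inj_mul.
by apply: (mulfI dR); rewrite (mulfV dR) mulrA -KM (mulfV KR).
Qed.

Definition pair_products : seq N :=
  [seq (p * q)%num | p <- [:: 2; 3; 5; 7; 11; 13; 17]%num,
                     q <- [seq q <- [:: 2; 3; 5; 7; 11; 13; 17]%num | N.ltb q p]].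

(** Here 510510 is the primorial of 17. The run of ones from 140390 to 248873 contains all [M] with
    [11 / 40 <= M / 510510 <= 39 / 80]. *)
Lemma divisor_sums_run :
  N.eqb (N.land (N.shiftr (divisor_sums 510510 pair_products) 140390) (N.ones 108484))
    (N.ones 108484).
Proof. by vm_cast_no_check (erefl true). Qed.

Lemma primorial17 : primorial 17 = N.to_nat 510510.
Proof.
rewrite /primorial (_ : primes_upto 17 = [:: 2; 3; 5; 7; 11; 13; 17]%N) //.
by rewrite !big_cons big_nil; lia.
Qed.

Lemma filled17_range (K M : N) : K = 510510%num ->
  11 / 40 <= ((N.to_nat M)%:R / (N.to_nat K)%:R : rat) <= 39 / 80 ->
  (140390 <= M < 140390 + 108484)%num.
Proof.
move=> KE; have KR : 0 < (N.to_nat K)%:R :> rat by rewrite ltr0n; lia.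
have KN : (N.to_nat K)%:R != 0 :> rat by rewrite (gt_eqF KR).
case/andP => /(ler_wpM2r (ltW KR)) r1 /(ler_wpM2r (ltW KR)) r2.
rewrite (divfK KN) in r1 r2.
have h1 : (11 * N.to_nat K <= 40 * N.to_nat M)%N.
  by rewrite -(ler_nat rat) !natrM; clear KE; lra.
have h2 : (80 * N.to_nat M <= 39 * N.to_nat K)%N.
  by rewrite -(ler_nat rat) !natrM; clear KE; lra.
by clear r1 r2 KR; lia.
Qed.

Lemma mem_pair_products d : d \in pair_products ->
  two_primes_upto 17 (N.to_nat d) /\ N.modulo 510510 d = 0%num.
Proof.
have H0 : all (fun d => N.eqb (N.modulo 510510 d) 0) pair_products by [].
move=> dL; split; last by apply/N.eqb_eq; apply: (allP H0).
clear H0; case/allpairsPdep: dL => p [q [pL qL ->]].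
have pr r : r \in [:: 2; 3; 5; 7; 11; 13; 17]%num -> prime (N.to_nat r) && (N.to_nat r <= 17)%N.
  by apply/allP: r.
move: qL; rewrite mem_filter => /andP[/N.ltb_lt qp /pr/andP[pq _]].
have /andP[pp p17] := pr _ pL; exists (N.to_nat p), (N.to_nat q).
by clear pr pL; split=> //; lia.
Qed.

Lemma filled17 : filled (two_primes_upto 17) 17 (11 / 40) (39 / 80).
Proof.
apply: (@filled_of_run 17 510510 140390 108484 pair_products).
- exact: primorial17.
- by [].
- exact: mem_pair_products.
- by move=> M; apply: filled17_range.
exact/N.eqb_eq/divisor_sums_run.
Qed.

(** * Induction over the primes for products of two primes *)

Lemma filled_sub (P Q : nat -> Prop) (n : nat) (al be al' be' : rat) :
  (forall m, P m -> Q m) -> al <= al' -> be' <= be ->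
  filled P n al be -> filled Q n al' be'.
Proof.
move=> PQ ala beb H M /andP[h1 h2].
have [|s [us sP sE]] := H M; first by rewrite (le_trans ala h1) (le_trans h2 beb).
by exists s; split=> // m /sP/PQ.
Qed.

Lemma filledS_nonprime (P : nat -> Prop) (n : nat) (al be : rat) :
  ~~ prime n.+1 -> filled P n al be -> filled P n.+1 al be.
Proof. by move=> np H M; rewrite /primorial primes_uptoS (negbTE np); exact: H. Qed.

Lemma two_primes_uptoS (n m : nat) : two_primes_upto n m -> two_primes_upto n.+1 m.
Proof.
by case=> p [q [pp pq /andP[qp pn] ->]]; exists p, q; rewrite qp leqW.
Qed.

(** Provides the length condition of [interval2_step] for every interval of length at least
    [1 / 8]. *)
Lemma usum_primes_upto_le (n : nat) :
  (18 <= n)%N -> usum (primes_upto n) <= n.+1%:R / 8.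
Proof.
move=> n18; rewrite -(subnK n18); move: (n - 18)%N => d {n n18}.
elim: d => [|d IHd].
  rewrite add0n (_ : primes_upto 18 = [:: 2; 3; 5; 7; 11; 13; 17]%N) //.
  rewrite !usum_cons [usum [::]]big_nil; lra.
rewrite addSn; have [pr|np] := boolP (prime (d + 18).+1); last first.
  by rewrite primes_uptoS (negbTE np) -natr1; move: IHd; lra.
rewrite usum_primes_uptoS // -[(d + 18).+2%:R]natr1.
have : ((d + 18).+1%:R)^-1 <= (8%:R)^-1 :> rat.
  by rewrite lef_pV2 ?posrE ?ltr0n // ler_nat; lia.
by move: IHd; move: (usum _) (_.+1%:R^-1) (_.+1%:R) => a b c; lra.
Qed.

(** The bound on [al] is kept because a step at the prime [n.+1] raises [al] by at most [1 / n.+1],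
    light covers having sum at most 1. It makes [al] small compared with [n]. *)
Definition two_prime_interval (n : nat) (al be : rat) : Prop :=
  [/\ 0 <= al, al <= 1 + usum (primes_upto n), 1 / 8 <= be - al &
    filled (two_primes_upto n) n al be].

(** The prime 19 lies below the range of [light_coverP]. The cover used here weighs slightly more
    than half of the total, so the interval shrinks a little, but its initial length [17 / 80]
    leaves room above [1 / 8]. *)
Lemma two_prime_interval19 : exists al be, two_prime_interval 19 al be.
Proof.
have pr19 : prime 19 by [].
have U18 : primes_upto 18 = [:: 2; 3; 5; 7; 11; 13; 17]%N by [].
pose B := [:: 3; 7; 11; 13; 17]%N.
have cB : covers 19 B.
  have -> : 19%N = N.to_nat 19 by [].
  have -> : B = map N.to_nat [:: 3; 7; 11; 13; 17]%num by [].
  by apply: covers_reach => //; vm_compute.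
have wB : usum B <= 71 / 100.
  by rewrite !usum_cons [usum [::]]big_nil; lra.
have E18 : usum (primes_upto 18) = 1 / 2 + 1 / 3 + 1 / 5 + 1 / 7 + 1 / 11 + 1 / 13 + 1 / 17.
  by rewrite U18 !usum_cons [usum [::]]big_nil; lra.
have H18 : filled (two_primes_upto 18) 18 (11 / 40) (39 / 80).
  have np18 : ~~ prime 18 by [].
  exact: filled_sub (@two_primes_uptoS 17) (lexx _) (lexx _) (filledS_nonprime np18 filled17).
have BU : {subset B <= primes_upto 18} by rewrite U18; apply/allP.
have a0 : 0 <= 11 / 40 :> rat by lra.
have len : usum (primes_upto 18) <= 19%:R * (39 / 80 - 11 / 40).
  by rewrite E18; clear; lra.
have uB : uniq B by [].
have H19 := interval2_step pr19 a0 uB BU cB wB len H18.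
do 2!eexists; split; last exact: H19; clear H19 H18 cB wB.
- by clear; lra.
- by rewrite (usum_primes_uptoS pr19) E18; clear; lra.
by rewrite E18; clear; lra.
Qed.

Lemma exists_two_prime_interval (n : nat) :
  (19 <= n)%N -> exists al be, two_prime_interval n al be.
Proof.
move=> n19; rewrite -(subnK n19); move: (n - 19)%N => d {n n19}.
elim: d => [|d [al [be [al0 alU len H]]]]; first exact: two_prime_interval19.
rewrite addSn; have [pr|np] := boolP (prime (d + 19).+1); last first.
  exists al, be; split=> //; first by rewrite primes_uptoS (negbTE np).
  exact: filled_sub (@two_primes_uptoS _) (lexx _) (lexx _) (filledS_nonprime np H).
have n22 : (22 <= d + 19)%N by case: d pr {al0 alU len H} => [|[|[|d]]] //; lia.
have [B [uB BU cB B1 B2]] := light_coverP pr n22.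
set n := (d + 19)%N in pr n22 BU cB B2 alU H *.
have pR : 0 < n.+1%:R :> rat by rewrite ltr0n.
have n18 : (18 <= n)%N by lia.
clearbody n.
have Hl : usum (primes_upto n) <= n.+1%:R * (be - al).
  apply: le_trans (usum_primes_upto_le n18) _.
  by rewrite ler_pM2l //; move: len; lra.
have H' := interval2_step pr al0 uB BU cB (lexx _) Hl H.
exists (al + usum B / n.+1%:R), (be + (usum (primes_upto n) - usum B) / n.+1%:R).
have w0 : 0 <= usum B / n.+1%:R by rewrite divr_ge0 ?usum_ge0 // ltW.
have w1 : usum B / n.+1%:R <= (n.+1%:R)^-1.
  by rewrite ler_pdivrMr // mulVf // gt_eqF.
have w2 : usum B / n.+1%:R <= (usum (primes_upto n) - usum B) / n.+1%:R.
  by rewrite ler_pM2r ?invr_gt0 //; lra.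
split; last exact: H'.
- exact: addr_ge0.
- rewrite usum_primes_uptoS //; move: alU w1; clear.
  by move: (_.+1%:R^-1) (usum B / _) (usum _) => a b c; lra.
move: len w2; by clear; move: (usum B / _) ((_ - _) / _) => a b; lra.
Qed.

(** * Products of three primes *)

(* The clause [p <= l \/ 3 < r] keeps the multiples 6 * p with p > l out, for the
   greedy step. *)
Definition three_primes_upto (l n m : nat) : Prop :=
  exists p q r : nat, [/\ [/\ prime p, prime q & prime r], (r < q < p)%N, (p <= n)%N,
    (p <= l)%N \/ (3 < r)%N & m = (p * q * r)%N].

Lemma three_primes_uptoS (l n m : nat) :
  three_primes_upto l n m -> three_primes_upto l n.+1 m.
Proof.
by case=> p [q [r [pr lt pn pl ->]]]; exists p, q, r; split=> //; exact: leqW.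
Qed.

Lemma three_prime_base (n : nat) (al be : rat) :
  prime n.+1 -> filled (two_primes_upto n) n al be ->
  filled (three_primes_upto n.+1 n.+1) n.+1 (al / n.+1%:R) (be / n.+1%:R).
Proof.
move=> pr H M; rewrite primorialS_prime // natrM invfM mulrCA [n.+1%:R^-1 * _]mulrC.
have pR : 0 < n.+1%:R^-1 :> rat by rewrite invr_gt0 ltr0n.
rewrite !ler_pM2r // => /H[s [us sP sE]].
exists (map (muln n.+1) s); split.
- by rewrite map_inj_uniq // => a b /eqP; rewrite eqn_pmul2l // => /eqP.
- move=> _ /mapP[m /sP[p [q [pp pq /andP[qp pn] ->]]] ->].
  exists n.+1, p, q; split=> //; [by rewrite qp ltnS|by left|by rewrite mulnA].
by rewrite usum_map_mul sE mulrC.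
Qed.

(** Only the lower end moves. The denominators [r * q] with [q] in [T] again form a cover,
    multiplication by [r] permuting the residues, and their total weight [usum T / r] is at most
    [w], so a large [r] makes the loss [w / n.+1] tiny. *)
Lemma three_prime_step (l n r : nat) (T : seq nat) (al be w : rat) :
  prime n.+1 -> 0 <= al -> prime r -> (3 < r <= n)%N -> uniq T ->
  (forall q, q \in T -> q \in primes_upto n /\ (r < q)%N) -> covers n.+1 T ->
  usum T <= r%:R * w ->
  filled (three_primes_upto l n) n al be ->
  filled (three_primes_upto l n.+1) n.+1 (al + w / n.+1%:R) be.
Proof.
move=> pr al0 pr_r /andP[r3 rn] uT TP cT wT H M; rewrite primorialS_prime //.
set N := primorial n; set p := n.+1; set y := M%:R / _ => /andP[y1 y2].
have N0 : (0 < N)%N := primorial_gt0 n.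
have pR : 0 < p%:R :> rat by rewrite ltr0n.
have rR : 0 < r%:R :> rat by rewrite ltr0n prime_gt0.
have pN : ~~ (p %| N)%N by apply: prime_ndvd_primorial.
have TN m : m \in map (muln r) T -> (m %| N)%N.
  case/mapP=> q /TP[]; rewrite mem_primes_upto => /andP[pq qn] rq ->.
  have := @dvdn_prod_primes [:: r; q] N; rewrite !big_cons big_nil muln1; apply.
    by rewrite /= inE andbT neq_ltn rq.
  move=> z; rewrite !inE => /orP[] /eqP ->; rewrite ?pq ?pr_r; exact: prime_dvd_primorial.
have rF : (r%:R : 'F_p) != 0 by apply: natF_neq0; rewrite ?prime_gt0 ?ltnS.
have [s [c [sT sc cM]]] := covers_residue M pr pN TN (covers_mull pr rF cT).
have us : uniq s.
  apply: subseq_uniq sT _; rewrite map_inj_uniq // => a b /eqP.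
  by rewrite eqn_pmul2l ?prime_gt0 // => /eqP.
have sw : usum s <= w.
  apply: le_trans (usum_subset us (mem_subseq sT)) _.
  by rewrite usum_map_mul mulrC ler_pdivrMr // mulrC.
have swp : usum s / p%:R <= w / p%:R by rewrite ler_pM2r ?invr_gt0.
have s0 : 0 <= usum s / p%:R by rewrite divr_ge0 ?usum_ge0 ?ltW.
have le : usum s / p%:R <= y by move: al0 y1 swp; clear; lra.
have [M' M'E] := quotient_by_new_prime (ltn0Sn n) N0 sc cM le.
have rng : al <= M'%:R / N%:R <= be.
  by rewrite M'E -/p -/y; apply/andP; split; move: y1 y2 swp s0; clear; lra.
have [s2 [us2 s2P s2E]] := H M' rng.
exists (s2 ++ map (muln p) s); split.
- rewrite cat_uniq us2 map_inj_uniq ?us ?andbT; last first.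
    by move=> a b /eqP; rewrite eqn_pmul2l // => /eqP.
  apply/hasPn => _ /mapP[m ms ->]; apply/negP.
  move=> /s2P[p1 [q1 [r1 [[pr1 pr2 pr3] /andP[h1 h2] h3 _ E]]]].
  have : (p %| p1 * q1 * r1)%N by rewrite -E dvdn_mulr.
  rewrite !Euclid_dvdM // !dvdn_prime2 // => /orP[/orP[]|] /eqP pE.
  + by move: h3; rewrite -pE ltnn.
  + by move: (leq_trans h2 (leqW h3)); rewrite -pE ltnn.
  by move: (leq_trans (ltn_trans h1 h2) (leqW h3)); rewrite -pE ltnn.
- move=> m; rewrite mem_cat => /orP[/s2P/three_primes_uptoS //|].
  case/mapP=> u /(mem_subseq sT)/mapP[q qT ->] ->.
  have [] := TP q qT; rewrite mem_primes_upto => /andP[pq qn] rq.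
  exists p, q, r; split=> //.
  + by rewrite rq ltnS.
  + by right.
  by rewrite -mulnA [(r * q)%N]mulnC.
by rewrite usum_cat usum_map_mul s2E M'E [p%:R^-1 * _]mulrC subrK.
Qed.

Lemma expn4_le_exp2 (e : nat) : (48 <= e)%N -> (256 * (256 * (256 * e ^ 4)) <= 2 ^ e)%N.
Proof.
move=> e48; rewrite -(subnK e48); move: (e - 48)%N => d {e e48}.
elim: d => [|d IHd]; first by lia.
rewrite addSn [(2 ^ _.+1)%N]expnS; apply: leq_trans (leq_mul (leqnn 2) IHd).
suff : ((d + 48).+1 ^ 4 <= 2 * (d + 48) ^ 4)%N.
  by move: (_ ^ 4)%N ((d + 48) ^ 4)%N => x z; lia.
rewrite -[4%N]/(2 * 2)%N !expnM -!mulnn; set x := (d + 48)%N.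
have x48 : (48 <= x)%N by rewrite leq_addl.
have h : (5 * (x.+1 * x.+1) <= 6 * (x * x))%N by nia.
move: h; move: (x.+1 * x.+1)%N (x * x)%N => a b h.
by nia.
Qed.

(** Otherwise [e > 48] and [v + 1 <= 100 e ^ 2], hence [2 ^ e <= 128 * 10 ^ 4 * e ^ 4], which is
    less than the lower bound [256 ^ 3 * e ^ 4] of [expn4_le_exp2]. *)
Lemma eventually_exponent_small (v e : nat) :
  (100 * (48 * 48) <= v)%N -> (2 ^ e <= 128 * v.+1 ^ 2)%N -> (100 * (e * e) <= v)%N.
Proof.
move=> v1 h; rewrite leqNgt; apply/negP => ve.
have e48 : (48 <= e)%N by nia.
have := expn4_le_exp2 e48; have : (v.+1 ^ 2 <= (100 * (e * e)) ^ 2)%N by rewrite leq_exp2r.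
have -> : (e ^ 4 = (e * e) * (e * e))%N by rewrite (expnD e 2 2) -mulnn.
rewrite -!mulnn in h *.
have -> : (100 * (e * e) * (100 * (e * e)) = 100 * 100 * (e * e * (e * e)))%N by ring.
have e1 : (0 < e * e * (e * e))%N by rewrite !muln_gt0; lia.
by move: e1 h; move: (e * e * (e * e))%N (v.+1 * v.+1)%N (2 ^ e)%N => a b c; lia.
Qed.

(* With [2 ^ e] of the order of [v ^ 2] and [n] of the order of [64 * v ^ 2],
   Chebyshev's bound provides about [64 * v ^ 2 / e] primes, of which the cover uses
   only [36 * v.+1]. *)
Lemma exists_sparse_cover : exists n0, forall n, (n0 <= n)%N -> prime n.+1 ->
  exists r T, [/\ prime r, (3 < r <= n)%N, uniq T /\
    (forall q, q \in T -> q \in primes_upto n /\ (r < q)%N), covers n.+1 T &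
    usum T <= r%:R * (16 * n.+1%:R)^-1].
Proof.
have [c cE] : exists c, c = (100 * (48 * 48))%N by eexists.
have c16 : (16 <= c)%N by rewrite cE; lia.
exists (64 * (c + 1) ^ 2)%N => n n0 pr.
have [|v [v16 v1 v2]] := @exists_sqrt64 n.+1.
  by apply: leq_trans (leqW n0); rewrite addn1 -mulnn; nia.
have vbig : (c <= v)%N.
  have : (64 * (c + 1) ^ 2 < 64 * v.+1 ^ 2)%N by apply: leq_trans v2; rewrite ltnS.
  by rewrite ltn_mul2l /= ltn_exp2r // addn1 ltnS => /ltnW.
rewrite cE in vbig.
have [e [he ev e2]] := size_primes_upto_prime pr v16 v1 v2.
have ee := eventually_exponent_small vbig e2.
set k := size (primes_upto n) in he *.
(* Combines [100 e ^ 2 <= v] with Chebyshev's [64 v ^ 2 <= e (k + 1)], squared. *)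
have k2 : (640 * 640 * (v * v * v) <= k.+1 * k.+1)%N.
  rewrite -(@leq_pmul2l v); last by lia.
  apply: (@leq_trans (100 * (e * e) * (k.+1 * k.+1))); last by rewrite leq_mul2r ee orbT.
  have := leq_mul he he; rewrite -mulnn => H.
  have -> : (100 * (e * e) * (k.+1 * k.+1) = 100 * (e * k.+1 * (e * k.+1)))%N by ring.
  apply: (@leq_trans (100 * (64 * (v * v) * (64 * (v * v))))); last by rewrite leq_mul2l H.
  have -> : (100 * (64 * (v * v) * (64 * (v * v))) =
    10 * 10 * (64 * 64) * (v * (v * v * v)))%N by ring.
  have -> : (v * (640 * 640 * (v * v * v)) = 640 * 640 * (v * (v * v * v)))%N by ring.
  by move: (v * _)%N => z; lia.
have k1 : (640 * v <= k.+1)%N.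
  rewrite -(@leq_exp2r _ _ 2) // -!mulnn; apply: leq_trans k2.
  have -> : (640 * v * (640 * v) = 640 * 640 * (v * v))%N by ring.
  by rewrite leq_mul2l leq_pmulr ?orbT //; lia.
set h := (36 * v.+1)%N; set j := (k - h)%N.
have jk : (j.-1 < k)%N by rewrite /j /h; lia.
have j0 : j = j.-1.+1 by rewrite /j /h; lia.
(* The prime just before the top ones: it is smaller than all of [T], yet at least [k + 1]. *)
set r := nth 0%N (primes_upto n) j.-1.
have dE : drop j.-1 (primes_upto n) = r :: top_primes n v.
  by rewrite (drop_nth 0%N) // -j0.
have rD : r \in drop j.-1 (primes_upto n) by rewrite dE mem_head.
have rge : (k.+1 <= r)%N.
  by apply: leq_trans (drop_primes_upto_ge rD); rewrite /j /h; lia.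
have := mem_drop rD; rewrite mem_primes_upto => /andP[pr_r rn].
have rT q : q \in top_primes n v -> (r < q)%N.
  have : sorted ltn (drop j.-1 (primes_upto n)).
    by apply: drop_sorted; apply: sorted_filter; [exact: ltn_trans|exact: iota_ltn_sorted].
  by rewrite dE /= => /(order_path_min ltn_trans)/allP H /H.
exists r, (top_primes n v); split=> //.
- by rewrite rn andbT; lia.
- split; first exact: top_primes_uniq.
  by move=> q qT; split; [case/mem_top_primes: qT | exact: rT].
- by apply: covers_top_primes; rewrite // -/k; lia.
have bT q : q \in top_primes n v -> (k.+1 <= q)%N.
  by move=> /rT /ltnW; apply: leq_trans.
apply: le_trans (usum_le_const (ltn0Sn k) bT) _.
rewrite size_top_primes -/k; last by lia.
rewrite ler_pdivrMr ?ltr0n // mulrAC -natrM ler_pdivlMr ?mulr_gt0 ?ltr0n //.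
rewrite -!natrM ler_nat -/h.
(* What remains is [16 h (n + 1) <= (k + 1) r]. The left side is at most
   [36 * 16 * 64 * (v + 1) ^ 3], the right side at least [640 ^ 2 * v ^ 3]. *)
apply: (@leq_trans (k.+1 * k.+1)); last by rewrite leq_mul2r rge orbT.
apply: leq_trans k2.
apply: (@leq_trans (h * (16 * (64 * v.+1 ^ 2)))); first by rewrite !leq_mul2l v2 !orbT.
rewrite /h -mulnn.
have -> : (36 * v.+1 * (16 * (64 * (v.+1 * v.+1))) = 36 * 16 * 64 * (v.+1 * v.+1 * v.+1))%N.
  by ring.
have v3 : (v.+1 * v.+1 * v.+1 <= 2 * (v * v * v))%N by nia.
by move: v3; move: (v.+1 * _ * _)%N (v * v * v)%N => a b; lia.
Qed.

(** With [w = 1 / (16 p)] a prime [p = n.+1] raises the lower end by [1 / (16 p ^ 2)], at most a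
    sixteenth of [1/n - 1/p]. These bounds telescope, so the total rise stays below [1 / (16 l)]. *)
Lemma three_prime_interval (l n0 : nat) (al be : rat) :
  (0 < l)%N -> 0 <= al ->
  (forall n, (l <= n)%N -> prime n.+1 ->
    exists r T, [/\ prime r, (3 < r <= n)%N, uniq T /\
      (forall q, q \in T -> q \in primes_upto n /\ (r < q)%N), covers n.+1 T &
      usum T <= r%:R * (16 * n.+1%:R)^-1]) ->
  filled (three_primes_upto l l) l al be ->
  forall n, (l <= n)%N ->
  filled (three_primes_upto l n) n (al + ((l%:R)^-1 - (n%:R)^-1) / 16) be.
Proof.
move=> l0 al0 cover H n ln; rewrite -(subnK ln); move: (n - l)%N => d {n ln}.
elim: d => [|d IHd]; first by rewrite add0n subrr mul0r addr0.
rewrite addSn; set n := (d + l)%N in IHd *.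
have ln : (l <= n)%N by rewrite leq_addl.
clearbody n; have n0' : (0 < n)%N by apply: leq_trans ln.
have nR : 0 < n%:R :> rat by rewrite ltr0n.
have nR1 : 0 < n.+1%:R :> rat by rewrite ltr0n.
have le1 : (n.+1%:R)^-1 <= (n%:R)^-1 :> rat by rewrite lef_pV2 ?posrE // ler_nat.
have le2 : (n%:R)^-1 <= (l%:R)^-1 :> rat by rewrite lef_pV2 ?posrE ?ltr0n // ler_nat.
have [pr|np] := boolP (prime n.+1); last first.
  apply: filled_sub (@three_primes_uptoS l n) _ (lexx _) (filledS_nonprime np IHd).
  by move: le1; clear; move: (_.+1%:R^-1) (n%:R^-1) (l%:R^-1) => a b c; lra.
have [r [T [pr_r r3 [uT TP] cT wT]]] := cover n ln pr.
have al1 : 0 <= al + ((l%:R)^-1 - (n%:R)^-1) / 16.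
  by move: al0 le2; clear; move: (n%:R^-1) (l%:R^-1) => a b; lra.
have := three_prime_step pr al1 pr_r r3 uT TP cT wT IHd.
apply: filled_sub => //; rewrite -addrA lerD2l.
have E : (n%:R)^-1 - (n.+1%:R)^-1 = (n%:R)^-1 / n.+1%:R :> rat.
  by rewrite -natr1; field; rewrite natr1 !gt_eqF.
have le3 : (n.+1%:R)^-1 / n.+1%:R <= (n%:R)^-1 - (n.+1%:R)^-1 :> rat.
  by rewrite E ler_pM2r // invr_gt0.
rewrite invfM -[_^-1 * _ / _]mulrA.
by move: le3; clear; set a := n.+1%:R^-1 / n.+1%:R;
  move: a (n.+1%:R^-1) (n%:R^-1) (l%:R^-1) => a b c d; lra.
Qed.

(** * Greedy subtraction and the conclusion *)

Lemma exists_step_between (f : nat -> rat) (x lo hi eta : rat) :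
  f 0%N = 0 -> (forall n, f n.+1 <= f n + eta) -> (exists n, x - hi <= f n) ->
  lo <= x -> eta <= hi - lo -> exists n, lo <= x - f n <= hi.
Proof.
move=> f0 fS [n0 fn0] lox le.
have ex : exists n, x - f n <= hi by exists n0; lra.
(* At the first [n] with [x - f n <= hi] the preceding value was above [hi], and one step is no
   longer than the interval. *)
case: (ex_minnP ex) => [[|n]] h1 h2; first by exists 0%N; rewrite h1 f0 subr0 lox.
exists n.+1; rewrite h1 andbT.
have : ~~ (x - f n <= hi) by apply/negP => /h2; rewrite ltnn.
by rewrite -ltNge; have := fS n; lra.
Qed.

Definition large_primes_upto (c n : nat) : seq nat := [seq q <- primes_upto n | (c < q)%N].

Lemma usum_large_primes_uptoS (c n : nat) :
  usum (large_primes_upto c n.+1) <= usum (large_primes_upto c n) + (c.+1%:R)^-1.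
Proof.
have c0 : 0 <= (c.+1%:R)^-1 :> rat by rewrite invr_ge0 ler0n.
rewrite /large_primes_upto primes_uptoS; case: ifP => _; last by rewrite lerDl.
rewrite filter_rcons; case: ifP => cn; last by rewrite lerDl.
rewrite -cats1 usum_cat usum_seq1 lerD2l lef_pV2 ?posrE ?ltr0n // ler_nat.
exact: cn.
Qed.

Lemma usum_large_primes_upto_unbounded (c : nat) (x : rat) :
  exists n, x <= usum (large_primes_upto c n).
Proof.
have [n nx] := usum_primes_upto_unbounded (x + usum (primes_upto c)).
exists n; have E := usum_filterC (fun q => c < q)%N (primes_upto n).
have : usum [seq q <- primes_upto n | ~~ (c < q)%N] <= usum (primes_upto c).
  apply: usum_subset; first by rewrite filter_uniq ?primes_upto_uniq.
  by move=> q; rewrite mem_filter !mem_primes_upto -leqNgt => /andP[-> /andP[-> _]].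
by move: E nx; rewrite -/(large_primes_upto c n); lra.
Qed.

Lemma squarefree_dvd_primorial (b n : nat) :
  (0 < b <= n)%N -> squarefree b -> (b %| primorial n)%N.
Proof.
move=> /andP[b0 bn] sq; rewrite [b](prod_prime_decomp b0) prime_decompE big_map /=.
have -> : (\prod_(q <- primes b) q ^ logn q b = \prod_(q <- primes b) q)%N.
  apply: eq_big_seq => q; rewrite mem_primes => /and3P[pq _ qb].
  have [l1|l2] := leqP (logn q b) 1.
    have : (0 < logn q b)%N by rewrite logn_gt0 mem_primes pq b0.
    by case: (logn q b) l1 => [|[|]] //; rewrite expn1.
  have /sq q1 : (q * q %| b)%N by rewrite mulnn pfactor_dvdn.
  by rewrite q1 in pq.
apply: dvdn_prod_primes; first exact: primes_uniq.
move=> q; rewrite mem_primes => /and3P[pq _ qb]; rewrite pq.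
by apply: prime_dvd_primorial; rewrite // (leq_trans _ bn) // dvdn_leq.
Qed.

(** An interval from [al] to [be] of length at least [1 / 8] for two primes is divided by the prime
    [l]. Later primes cost at most [1 / (16 l)] at its lower end, hence [lo = (al + 1 / 16) / l],
    and [1 / (16 l)] of the length survives. *)
Lemma exists_short_interval (x : rat) : 0 < x ->
  exists l lo hi, [/\ (3 < l)%N, prime l, 0 <= lo <= x, (16 * l%:R)^-1 <= hi - lo &
    forall n, (l <= n)%N -> filled (three_primes_upto l n) n lo hi].
Proof.
move=> x0; have [n0 cover] := exists_sparse_cover.
have [m m0 mx] : exists2 m, (0 < m)%N & 2 <= x * m%:R.
  exists (Num.bound (2 / x)).+1 => //; have := archi_boundP (ltW (divr_gt0 (ltr0n _ 2) x0)).
  rewrite ltr_pdivrMr // => h; rewrite -natr1 mulrDr mulr1 mulrC.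
  by move: h x0; set a := _ * x; lra.
(* Up to constants [al] is at most [m + n / m]. As [2 <= x m], the term [n / m] is at most
   [n x / 2], and [n >= m (m + 2)] bounds [m + 2] likewise, so [lo <= x]. *)
have [l lbig pr] := prime_above (maxn (maxn n0 20) (m * (m + 2))).
case: l lbig pr => // n lbig pr.
have n19 : (19 <= n)%N by lia.
have [al [be [al0 alU len H]]] := exists_two_prime_interval n19.
have lR : 0 < n.+1%:R :> rat by rewrite ltr0n.
have H3 := three_prime_base pr H.
have alx : (al + 1 / 16) / n.+1%:R <= x.
  rewrite ler_pdivrMr //.
  have h1 : usum (primes_upto n) <= m%:R + n%:R / m%:R.
    exact: le_trans (usum_primes_upto_le_iota n) (usum_iota_le n m0).
  have mR : 0 < m%:R :> rat by rewrite ltr0n.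
  have h2 : n%:R / m%:R <= n%:R * (x / 2).
    rewrite ler_wpM2l // ?ler0n // -[_^-1]mul1r ler_pdivrMr //; move: mx; lra.
  have h3 : m%:R + 2 <= n%:R * (x / 2).
    have : (m * (m + 2) <= n)%N by move: lbig; rewrite gtn_max ltnS => /andP[].
    rewrite -(ler_nat rat) natrM natrD => h3.
    have : m%:R * (m%:R + 2%:R) * (x / 2) <= n%:R * (x / 2).
      by rewrite ler_pM2r // divr_gt0.
    apply: le_trans; rewrite mulrC mulrA; set a := m%:R + 2%:R.
    have a0 : 0 < a by rewrite addr_gt0 ?ltr0n.
    by rewrite -[leLHS]mul1r ler_pM2r //; move: mx; lra.
  rewrite -[n.+1%:R]natr1 mulrDr mulr1 [x * _]mulrC.
  move: alU h1 h2 h3 x0; clear; rewrite mulrA; move: (usum _) (n%:R / _) => u a.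
  by move: (n%:R * x) => b; lra.
have n0n k : (n.+1 <= k)%N -> prime k.+1 -> exists r T, [/\ prime r, (3 < r <= k)%N, uniq T /\
      (forall q, q \in T -> q \in primes_upto k /\ (r < q)%N), covers k.+1 T &
      usum T <= r%:R * (16 * k.+1%:R)^-1].
  by move=> nk; apply: cover; lia.
have al1 : 0 <= al / n.+1%:R := divr_ge0 al0 (ltW lR).
have I3 := three_prime_interval n0 (ltn0Sn n) al1 n0n H3.
exists n.+1, ((al + 1 / 16) / n.+1%:R), (be / n.+1%:R); split.
- by clear -n19; lia.
- exact: pr.
- by rewrite alx andbT divr_ge0 ?(ltW lR) //; move: al0; clear; lra.
- by rewrite invfM -mulrBl ler_pM2r ?invr_gt0 //; move: len; clear; lra.
move=> k nk; apply: filled_sub (I3 k nk) => //.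
have : 0 <= (k%:R)^-1 :> rat by rewrite invr_ge0 ler0n.
rewrite [(al + 1 / 16) / _]mulrDl; clear.
by move: (al / n.+1%:R) (k%:R^-1) (n.+1%:R^-1) => c a b; lra.
Qed.

Lemma mem_large_primes_upto (c n q : nat) :
  (q \in large_primes_upto c n) = [&& (c < q)%N, prime q & (q <= n)%N].
Proof. by rewrite mem_filter mem_primes_upto. Qed.

(** The greedy terms are distinct from those of the interval. If all three primes are at most [l],
    none of them is [p]; if all exceed 3, none of them is 2. *)
Lemma mul6_not_three_primes (l n p : nat) : (3 < l)%N -> prime p -> (l < p)%N ->
  ~ three_primes_upto l n (6 * p).
Proof.
move=> l3 pp lp [p1 [q1 [r1 [[pr1 pr2 pr3] /andP[h1 h2] _ alt E]]]].
case: alt => h.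
  have : (p %| p1 * q1 * r1)%N by rewrite -E dvdn_mull.
  rewrite !Euclid_dvdM // !dvdn_prime2 // => /orP[/orP[]|] /eqP pE; lia.
have : (2 %| p1 * q1 * r1)%N by rewrite -E dvdn_mulr.
by rewrite !Euclid_dvdM // !dvdn_prime2 // => /orP[/orP[]|] /eqP pE; lia.
Qed.

Lemma three_primes_upto_product (l n m : nat) :
  three_primes_upto l n m -> product_of_three_distinct_primes m.
Proof.
case=> p [q [r [[pp pq pr] /andP[rq qp] _ _ ->]]]; exists p, q, r; split=> //.
by split=> //; split; lia.
Qed.

Lemma mul6_product (p : nat) : prime p -> (3 < p)%N ->
  product_of_three_distinct_primes (6 * p).
Proof. by move=> pp p3; exists 2, 3, p; split=> //; split=> //; split; lia. Qed.

Theorem theorem8p1 (a b : nat) (ha : (0 < a)%N) (hb : squarefree b) :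
  exists s : seq nat,
    uniq s /\
    (forall n : nat, n \in s -> product_of_three_distinct_primes n) /\
    a%:R / b%:R = \sum_(n <- s) (n%:R)^-1 :> rat.
Proof.
have b0 : (0 < b)%N.
  by case: b hb => // hb; have := hb 2 (dvdn0 _).
set x : rat := a%:R / b%:R.
have x0 : 0 < x by rewrite divr_gt0 ?ltr0n.
have [l [lo [hi [l3 pr_l /andP[lo0 lox] len H]]]] := exists_short_interval x0.
have lR : 0 < l%:R :> rat by rewrite ltr0n prime_gt0.
(* Primes above [3 l] make each greedy step at most [1 / (6 (3 l + 1))], below the length
   [1 / (16 l)] of the target interval. *)
pose f n : rat := (6%:R)^-1 * usum (large_primes_upto (3 * l) n).
have [|||||n /andP[n1 n2]] := @exists_step_between f x lo hi (16 * l%:R)^-1.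
- by rewrite /f /usum big_nil mulr0.
- move=> n; rewrite /f.
  have h : 6%:R^-1 * ((3 * l).+1%:R)^-1 <= (16 * l%:R)^-1 :> rat.
    rewrite -invfM -!natrM lef_pV2 ?posrE ?ltr0n ?muln_gt0 ?(prime_gt0 pr_l) //.
    by rewrite ler_nat; clear; lia.
  have := usum_large_primes_uptoS (3 * l) n; move: h; clear.
  by move: (usum _) (usum (large_primes_upto _ n)) ((3 * l).+1%:R^-1) ((16 * _)^-1) => v u c e; lra.
- have [n nx] := usum_large_primes_upto_unbounded (3 * l) (6%:R * (x - hi)).
  by exists n; rewrite /f ler_pdivlMl.
- exact: lox.
- exact: len.
(* The primorial of [m] must be divisible by [b] and by all greedy denominators, and the interval is
   available only from [l] on. *)
pose m := maxn n (maxn b l).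
have [nm bm lm] : [/\ n <= m, b <= m & l <= m]%N by rewrite !leq_max !leqnn !orbT.
set t := map (muln 6) (large_primes_upto (3 * l) n).
have tP q : q \in large_primes_upto (3 * l) n -> [/\ prime q, (3 * l < q)%N & (q <= m)%N].
  by rewrite mem_large_primes_upto => /and3P[? ? qn]; split=> //; exact: leq_trans nm.
have N0 := primorial_gt0 m.
have gt3 q : (3 * l < q)%N -> (3 < q)%N by apply: leq_ltn_trans; rewrite leq_pmulr ?prime_gt0.
have gtl q : (3 * l < q)%N -> (l < q)%N by apply: leq_ltn_trans; rewrite leq_pmull.
have tE : f n = usum t by rewrite /f /t usum_map_mul.
have tN d : d \in t -> (d %| primorial m)%N.
  case/mapP=> q /tP[pq /gt3 ql qm] ->.
  have := @dvdn_prod_primes [:: 2; 3; q] (primorial m).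
  rewrite !big_cons big_nil muln1 mulnA; apply.
    by rewrite /= !inE !negb_or !neq_ltn ql (ltn_trans _ ql).
  have m3 : (3 <= m)%N by apply: leq_trans qm; apply: ltnW.
  move=> z; rewrite !inE => /or3P[] /eqP ->; rewrite ?pq;
    by apply: prime_dvd_primorial; rewrite // ltnW.
have bN : (b %| primorial m)%N by apply: squarefree_dvd_primorial; rewrite ?b0.
(* Both [x] and [f n] are fractions over the primorial of [m]. The difference of numerators is a
   natural number because [x - f n >= lo >= 0]. *)
have [M ME] : exists M : nat, x - f n = M%:R / (primorial m)%:R.
  rewrite tE (usum_common_denominator N0 tN); set c := (\sum_(_ <- _) _)%N.
  have NR : 0 < (primorial m)%:R :> rat by rewrite ltr0n.
  have bR : b%:R != 0 :> rat by rewrite pnatr_eq0 -lt0n.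
  have xE : x = (a * (primorial m %/ b))%N%:R / (primorial m)%:R.
    rewrite -[in X in _ / X](divnK bN) !natrM invfM.
    have qR : (primorial m %/ b)%N%:R != 0 :> rat.
      by rewrite pnatr_eq0 -lt0n divn_gt0 // dvdn_leq.
    by rewrite /x; field; rewrite bR qR.
  exists (a * (primorial m %/ b) - c)%N.
  rewrite natrB ?mulrBl -?xE // -(ler_nat rat) -(ler_pM2r (x := (primorial m)%:R^-1)) ?invr_gt0 //.
  rewrite -xE -subr_ge0 (le_trans lo0) //.
  by rewrite tE (usum_common_denominator N0 tN) in n1.
have [s [us sP sE]] : exists s, [/\ uniq s, (forall d, d \in s -> three_primes_upto l m d) &
    usum s = M%:R / (primorial m)%:R].
  by apply: H => //; rewrite -ME n1 n2.
exists (s ++ t); split; last split.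
- rewrite cat_uniq us map_inj_uniq; last by move=> c d /eqP; rewrite eqn_pmul2l // => /eqP.
  rewrite filter_uniq ?primes_upto_uniq // andbT; apply/hasPn => _ /mapP[q /tP[pq ql _] ->].
  by apply/negP => /sP; apply: mul6_not_three_primes (gtl _ ql).
- move=> d; rewrite mem_cat => /orP[/sP/three_primes_upto_product //|].
  by case/mapP=> q /tP[pq /gt3 q3 _] ->; apply: mul6_product.
change (x = usum (s ++ t)); rewrite usum_cat sE -ME -tE subrK //.
Qed.
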